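(* Let $G$ be a biconnected graph and let $s=s_1s_2\dots s_k$ be a sequence of splits which, carried out successively starting from $G$ (each $s_i$ splits one of the graphs currently present), produces the triconnected components of $G$. Colour the virtual edges arising along the way as follows, starting from $G$ (which has no coloured edges); for $i=1,\dots,k$: (1) if $s_i$ is a non-supporting split, the two new virtual edges created by $s_i$ are coloured red; (2) if $s_i$ is a 2.5-split at some vertex-edge-separator $(c,e)$ of the graph being split such that $e$ is a green virtual edge or a non-virtual edge, let $e^{\star},e^{\star\star}$ be the two new virtual edges created by $s_i$; then every virtual edge (in any of the current graphs) whose label occurs as the label of a virtual edge on the ear of $e^{\star}$ or on the ear of $e^{\star\star}$ (ears taken in the graphs containing them) is coloured green; (3) if $s_i$ is a 2.5-split only at vertex-edge-separators $(c,e)$ with $e$ red, the two new virtual edges created by $s_i$ are coloured red. Then the resulting red/green colouring of the virtual edges of the triconnected components of $G$ does not depend on the choice of the sequence $s$.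
   Context: All graphs are finite, may have parallel edges, and have no loops. A graph of order 2 with $k\ge 2$ edges is a $k$-edge (multiedge). Each graph $H$ carries a possibly empty set $E_V(H)\subseteq E(H)$ of virtual edges with an injective labelling $\ell_H:E_V(H)\to\mathbb{N}$; other edges are non-virtual; the original graph $G$ has no virtual edges. A graph is biconnected if it is connected and for all pairwise distinct vertices $u,v,w$ there is a $u$-$v$ path avoiding $w$. Splits: for a biconnected $H$ and $u,v\in V(H)$, partition $E(H)$ into separation classes, two edges being in the same class iff they lie on a common (possibly closed) path having neither $u$ nor $v$ as an internal vertex. $\{u,v\}$ is a separation pair if some union $E'$ of some but not all classes has $\min\{|E'|,|E(H)\setminus E'|\}\ge 2$; a split then replaces $H$ by $H[E']+e_1$ and $H[E(H)\setminus E']+e_2$, where $e_1,e_2$ are new edges joining $u,v$, both virtual with the same new label not used before; other virtual edges keep their labels. $e_1,e_2$ correspond to each other. A merge is the inverse operation. A biconnected graph without separation pair is triconnected. Splitting repeatedly until no split is possible gives split components (triangles, 3-edges, other triconnected graphs); merging the triangles as much as possible into cycles and the 3-edges as much as possible into multiedges gives the triconnected components of $G$ (unique up to renaming/relabelling virtual edges, by Hopcroft–Tarjan). Vertex-edge-separators and 2.5-splits: for a biconnected graph $H$ which is not a triangle, $(c,uv)\in V(H)\times E(H)$ is a vertex-edge-separator if $H-uv-c$ is disconnected; then $H-uv-c$ has exactly two components $C_u\ni u$, $C_v\ni v$. For $a\in\{u,v\}$ with other endpoint $b$, let $H_a=H[V(C_a)\cup\{c\}]$, $H_b=H[V(C_b)\cup\{c\}]$.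 If $|E(H_a)|\ge2$, then $\{a,c\}$ is a separation pair supporting $(c,uv)$, and the split replacing $H$ by $H_a+ac$ and $H_b+ba+ac$ (the two new edges $ac$ being corresponding virtual edges, $ba$ being the edge $uv$) is the 2.5-split at $(c,uv)$ with support $\{a,c\}$. A split that is not of this form for any vertex-edge-separator is non-supporting. Ears: for $e\in E(H)$, the ear of $e$ in $H$ is the maximal (possibly closed) path in $H$ containing $e$ all of whose internal vertices have degree 2 in $H$. *)

(* Defs.v *)
From mathcomp Require Import all_boot.
Set Implicit Arguments. Unset Strict Implicit. Unset Printing Implicit Defensive.

(* Vertices are natural numbers.  An edge is ((kind), (u, v)) where the *)
(* kind is  inl i  for the i-th non-virtual edge of the original graph  *)
(* G (its identity), or  inr l  for a virtual edge with label l.        *)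
(* Within one graph the kinds are pairwise distinct (real edges have   *)
(* distinct identities; the labelling of virtual edges is injective),  *)
(* so parallel edges are distinguished by their kind.                   *)
Definition edge := ((nat + nat) * (nat * nat))%type.
Definition graph := (seq nat * seq edge)%type.

Definition verts (H : graph) : seq nat := H.1.
Definition edges (H : graph) : seq edge := H.2.
Definition ekind (f : edge) : nat + nat := f.1.
Definition eu (f : edge) : nat := f.2.1.
Definition ev (f : edge) : nat := f.2.2.
Definition is_real (f : edge) : bool := if f.1 is inl _ then true else false.

Definition joins (f : edge) (x y : nat) : bool :=
  ((eu f == x) && (ev f == y)) || ((eu f == y) && (ev f == x)).
Definition incident (f : edge) (x : nat) : bool := (eu f == x) || (ev f == x).
Definition deg (H : graph) (x : nat) : nat := count (fun f => incident f x) (edges H).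

Definition wf_graph (H : graph) : Prop :=
  uniq (verts H) /\ uniq (map ekind (edges H)) /\
  (forall f, f \in edges H -> [/\ eu f \in verts H, ev f \in verts H & eu f != ev f]).

Inductive reach (H : graph) (okv : pred nat) (oke : pred edge) (x : nat) : nat -> Prop :=
| reach_refl : x \in verts H -> okv x -> reach H okv oke x x
| reach_step y f z : reach H okv oke x y -> f \in edges H -> oke f -> joins f y z ->
    okv z -> reach H okv oke x z.

Definition connected (H : graph) : Prop :=
  forall x y, x \in verts H -> y \in verts H -> reach H predT predT x y.

Definition biconnected (H : graph) : Prop :=
  connected H /\
  forall u v w, u \in verts H -> v \in verts H -> w \in verts H ->
    u != v -> u != w -> v != w -> reach H (fun x => x != w) predT u v.

Fixpoint walk_ok (H : graph) (x : nat) (p : seq (edge * nat)) : Prop :=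
  match p with
  | [::] => True
  | (f, y) :: p' => f \in edges H /\ joins f x y /\ walk_ok H y p'
  end.

Definition is_path (H : graph) (x0 : nat) (p : seq (edge * nat)) : Prop :=
  walk_ok H x0 p /\ uniq (map fst p) /\
  (uniq (x0 :: map snd p) \/ (last x0 (map snd p) = x0 /\ uniq (map snd p))).

(* internal vertices x_1 .. x_{m-1} of the path x_0 .. x_m *)
Definition internal (x0 : nat) (p : seq (edge * nat)) : seq nat :=
  behead (belast x0 (map snd p)).

Definition same_class (H : graph) (u v : nat) (e f : edge) : Prop :=
  exists x0 p, [/\ is_path H x0 p, e \in map fst p, f \in map fst p,
    u \notin internal x0 p & v \notin internal x0 p].

(* P selects E' : a union of separation classes, with min(|E'|,|E\E'|) >= 2 *)
Definition sep_witness (H : graph) (u v : nat) (P : pred edge) : Prop :=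
  [/\ [/\ u \in verts H, v \in verts H & u != v],
      (forall e f, e \in edges H -> f \in edges H -> same_class H u v e f -> P e = P f),
      1 < count P (edges H) & 1 < count (predC P) (edges H)].

Definition separation_pair (H : graph) (u v : nat) : Prop :=
  exists P, sep_witness H u v P.

Definition can_split (H : graph) : Prop :=
  biconnected H /\ exists u v, separation_pair H u v.

Definition vedge (l u v : nat) : edge := (inr l, (u, v)).

Definition sub_graph (E : seq edge) (u v l : nat) : graph :=
  (undup (u :: v :: flatten [seq [:: eu f; ev f] | f <- E]), rcons E (vedge l u v)).

Definition labels_g (H : graph) : seq nat :=
  pmap (fun f : edge => if f.1 is inr l then Some l else None) (edges H).
Definition labels (C : seq graph) : seq nat := flatten (map labels_g C).

(* a split step: split the graph at position sidx of the current
   collection at pair {su,sv}, E' selected by sP, new label sl *)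
Record sstep := SStep { sidx : nat; su : nat; sv : nat; sP : pred edge; sl : nat }.

Definition g0 : graph := ([::], [::]).

Definition split_part1 (H : graph) (st : sstep) : graph :=
  sub_graph (filter (sP st) (edges H)) (su st) (sv st) (sl st).
Definition split_part2 (H : graph) (st : sstep) : graph :=
  sub_graph (filter (predC (sP st)) (edges H)) (su st) (sv st) (sl st).

Definition split_ok (C : seq graph) (st : sstep) (C' : seq graph) : Prop :=
  let H := nth g0 C (sidx st) in
  [/\ sidx st < size C, biconnected H, sep_witness H (su st) (sv st) (sP st),
      sl st \notin labels C &
      C' = take (sidx st) C ++ split_part1 H st :: split_part2 H st :: drop (sidx st).+1 C].

Inductive splits : seq graph -> seq sstep -> seq graph -> Prop :=
| splits_nil C : splits C [::] C
| splits_cons C st C' r C'' : split_ok C st C' -> splits C' r C'' -> splits C (st :: r) C''.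

Definition is_cycle (H : graph) : Prop :=
  connected H /\ 3 <= size (edges H) /\ (forall x, x \in verts H -> deg H x = 2).
Definition is_bond (H : graph) : Prop := size (verts H) = 2 /\ 2 <= size (edges H).
Definition is_triangle (H : graph) : Prop := is_cycle H /\ size (edges H) = 3.

Definition merge_ok (C : seq graph) (i j l : nat) (C' : seq graph) : Prop :=
  let H1 := nth g0 C i in let H2 := nth g0 C j in
  [/\ i < j, j < size C,
      exists u v, vedge l u v \in edges H1 /\
                  (vedge l u v \in edges H2 \/ vedge l v u \in edges H2) &
      C' = (undup (verts H1 ++ verts H2),
            filter (fun f : edge => f.1 != inr l) (edges H1 ++ edges H2))
           :: [seq x.2 | x <- zip (iota 0 (size C)) C & (x.1 != i) && (x.1 != j)]].

(* merges allowed when forming triconnected components: two cycles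
   (arising from triangles) or two multiedges (arising from 3-edges) *)
Definition typed_merge (C : seq graph) (i j l : nat) (C' : seq graph) : Prop :=
  merge_ok C i j l C' /\
  ((is_cycle (nth g0 C i) /\ is_cycle (nth g0 C j)) \/
   (is_bond (nth g0 C i) /\ is_bond (nth g0 C j))).

Inductive tmerges : seq graph -> seq graph -> Prop :=
| tmerges_nil C : tmerges C C
| tmerges_cons C i j l C' C'' : typed_merge C i j l C' -> tmerges C' C'' -> tmerges C C''.

Definition nrm (f : edge) : edge := (f.1, (minn (eu f) (ev f), maxn (eu f) (ev f))).
Definition same_graph (H H' : graph) : Prop :=
  verts H =i verts H' /\ perm_eq (map nrm (edges H)) (map nrm (edges H')).

Definition rename (s : nat -> nat) (f : edge) : edge :=
  (match f.1 with inl i => inl i | inr l => inr (s l) end, f.2).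
Definition rename_g (s : nat -> nat) (H : graph) : graph := (verts H, map (rename s) (edges H)).

Definition coll_iso (s : nat -> nat) (C1 C2 : seq graph) : Prop :=
  {in labels C1 &, injective s} /\ size C1 = size C2 /\
  exists pi : nat -> nat,
    [/\ (forall i, i < size C1 -> pi i < size C2),
        (forall i j, i < size C1 -> j < size C1 -> pi i = pi j -> i = j) &
        (forall i, i < size C1 -> same_graph (rename_g s (nth g0 C1 i)) (nth g0 C2 (pi i)))].

Definition is_tricomp (G : graph) (C : seq graph) : Prop :=
  exists r S C0, [/\ splits [:: G] r S, (forall H, H \in S -> ~ can_split H),
    tmerges S C0, ~ (exists i j l C', typed_merge C0 i j l C') & coll_iso id C0 C].

Definition vesep (H : graph) (c : nat) (e : edge) : Prop :=
  [/\ ~ is_triangle H, c \in verts H, e \in edges H, c != eu e & c != ev e] /\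
      exists x y, [/\ x \in verts H, y \in verts H, x != c, y != c &
        ~ reach H (fun z => z != c) (fun f => f != e) x y].

(* vertex x of H_a = H[V(C_a) u {c}] *)
Definition in_Ha (H : graph) (c : nat) (e : edge) (a x : nat) : Prop :=
  x = c \/ reach H (fun z => z != c) (fun f => f != e) a x.
Definition edge_in_Ha (H : graph) (c : nat) (e : edge) (a : nat) (f : edge) : Prop :=
  in_Ha H c e a (eu f) /\ in_Ha H c e a (ev f).

Definition twofive (H : graph) (st : sstep) (c : nat) (e : edge) : Prop :=
  vesep H c e /\
  exists a, [/\ (a == eu e) || (a == ev e),
    (exists f1 f2, [/\ f1 \in edges H, f2 \in edges H, f1 != f2,
                       edge_in_Ha H c e a f1 & edge_in_Ha H c e a f2]),
    (su st = a /\ sv st = c) \/ (su st = c /\ sv st = a) &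
    (forall f, f \in edges H -> (sP st f <-> edge_in_Ha H c e a f)) \/
    (forall f, f \in edges H -> (~~ sP st f <-> edge_in_Ha H c e a f))].

Definition deg2_internal (H : graph) (x0 : nat) (p : seq (edge * nat)) : bool :=
  all (fun x => deg H x == 2) (internal x0 p).

Definition is_ear (H : graph) (e : edge) (x0 : nat) (p : seq (edge * nat)) : Prop :=
  [/\ is_path H x0 p, e \in map fst p, deg2_internal H x0 p &
      forall y0 q, is_path H y0 q -> e \in map fst q -> deg2_internal H y0 q ->
        {subset map fst q <= map fst p}].

Definition on_ear (H : graph) (e : edge) (l : nat) : Prop :=
  exists x0 p, is_ear H e x0 p /\ inr l \in map (fun g : edge => g.1) (map fst p).

Inductive colour := Red | Green.

Definition upd (col : nat -> option colour) (l : nat) (c : colour) : nat -> option colour :=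
  fun k => if k == l then Some c else col k.

Definition colour_step (C : seq graph) (st : sstep) (col col' : nat -> option colour) : Prop :=
  let H := nth g0 C (sidx st) in
  let H1 := split_part1 H st in let H2 := split_part2 H st in
  let enew := vedge (sl st) (su st) (sv st) in
  let TF := exists c e, twofive H st c e in
  let G2 := exists c e, twofive H st c e /\
              (is_real e \/ exists m, e.1 = inr m /\ col m = Some Green) in
  let R3 := TF /\ forall c e, twofive H st c e -> exists m, e.1 = inr m /\ col m = Some Red in
  [/\ (~ TF -> col' = upd col (sl st) Red),
      (G2 -> forall k, ((on_ear H1 enew k \/ on_ear H2 enew k) -> col' k = Some Green) /\
                       (~ (on_ear H1 enew k \/ on_ear H2 enew k) -> col' k = col k)),
      (R3 -> col' = upd col (sl st) Red) &
      (TF -> ~ G2 -> ~ R3 -> col' = col)].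

Inductive crun : seq graph -> (nat -> option colour) -> seq sstep -> seq graph ->
                 (nat -> option colour) -> Prop :=
| crun_nil C col : crun C col [::] C col
| crun_cons C col st C' col' r C'' col'' :
    split_ok C st C' -> colour_step C st col col' -> crun C' col' r C'' col'' ->
    crun C col (st :: r) C'' col''.

(* Main.v *)
From Stdlib Require Import Classical.
Require Import Defs.
From mathcomp Require Import all_boot zify.
Set Implicit Arguments. Unset Strict Implicit. Unset Printing Implicit Defensive.

(** For a graph [H], call two edges ear-equivalent if they are linked by a chain of edges, two
    consecutive ones sharing a vertex of degree 2; the class of an edge is its ear.  A split at
    [{u, v}] is a 2.5-split at [(c, e)] exactly when one of the two parts has degree 2 at the end
    of the new edge other than [c], [e] being the other edge there.  Along a run, a label is green
    iff in one of the current graphs its ear contains a real edge, and red otherwise; this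
    description of the final colouring is invariant under isomorphism.  The invariant can only
    break when some label occurs in two graphs with an end of degree 2 in both.  This property
    persists under splits, and at the end it yields two cycles sharing a virtual edge, which
    the triconnected components do not have. *)

(** * Graphs and the two sides of a split *)

(** Two things could go wrong in a split. It could tear an ear apart: this needs a vertex of the
    pair with degree 2, and since both sides have an edge there, the new edge then has an end of
    degree 2 in both parts. Or the real edge that makes the edge of a vertex-edge-separator green
    could sit in a graph other than the one being split: there the label has an end of degree 2
    because its ear has a second edge, and in the part it has one because it meets the new edge at a
    vertex of degree 2. Either way one label has ends of degree 2 in two graphs.

    To exclude this at the end, two descriptions of the same collection must be compared: the run
    reaches it by splits alone, while the definition of triconnected components provides some other
    splits followed by merges. The splits of the definition end in graphs that cannot be split, and
    among these, given at least three edges, a vertex of degree 2 occurs only in a triangle. A count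
    of vertices shows that the merges cannot blur this distinction. *)

Lemma joinsC f x y : joins f x y = joins f y x.
Proof. by rewrite /joins orbC. Qed.

Lemma joins_incidentl f x y : joins f x y -> incident f x.
Proof. by rewrite /joins /incident; case/orP=> /andP[/eqP-> /eqP->]; rewrite eqxx ?orbT. Qed.

Lemma joins_incidentr f x y : joins f x y -> incident f y.
Proof. by rewrite joinsC; apply: joins_incidentl. Qed.

Lemma incident_joins f x : incident f x -> exists y, joins f x y.
Proof.
case/orP=> /eqP <-; first by exists (ev f); rewrite /joins !eqxx.
by exists (eu f); rewrite /joins !eqxx orbT.
Qed.

Lemma joins_end f x y z : joins f x y -> incident f z -> z = x \/ z = y.
Proof.
rewrite /joins /incident.
by case/orP=> /andP[/eqP-> /eqP->] /orP[] /eqP->; auto.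
Qed.

Definition loopless (H : graph) : Prop :=
  uniq (verts H) /\
  forall f, f \in edges H -> [/\ eu f \in verts H, ev f \in verts H & eu f != ev f].

Lemma wf_loopless H : wf_graph H -> loopless H.
Proof. by case=> ? [_ ?]. Qed.

Lemma wf_uniq_kinds H : wf_graph H -> uniq (map ekind (edges H)).
Proof. by case=> _ []. Qed.

Lemma wf_uniq_edges H : wf_graph H -> uniq (edges H).
Proof. by move/wf_uniq_kinds/map_uniq. Qed.

Lemma joins_neq H f x y : loopless H -> f \in edges H -> joins f x y -> x != y.
Proof.
move=> [_ L] /L [_ _ N]; rewrite /joins.
by case/orP=> /andP[/eqP<- /eqP<-] //; rewrite eq_sym.
Qed.

Lemma incident_vert H f x : loopless H -> f \in edges H -> incident f x -> x \in verts H.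
Proof. by move=> [_ L] /L [a b _] /orP[] /eqP <-. Qed.

Lemma end_neq H f x : loopless H -> f \in edges H -> exists2 y, incident f y & y != x.
Proof.
move=> [_ L] /L [_ _ N]; rewrite /incident.
case: (eqVneq (eu f) x) => [E|]; last by exists (eu f) => //; rewrite eqxx.
by exists (ev f); rewrite ?eqxx ?orbT // -E eq_sym.
Qed.

Lemma reach_ok H okv oke x y : reach H okv oke x y -> okv y.
Proof. by case. Qed.

Lemma reach_trans H okv oke x y z :
  reach H okv oke x y -> reach H okv oke y z -> reach H okv oke x z.
Proof.
move=> xy; elim=> [//|w f t _ IH fH ok J ot].
exact: reach_step IH fH ok J ot.
Qed.

Lemma reach_edge_incident H okv oke x y :
  reach H okv oke x y -> x != y -> exists2 f, f \in edges H & incident f y.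
Proof.
case=> [_ _|w f z _ fH _ J _ _]; first by rewrite eqxx.
by exists f => //; apply: joins_incidentr J.
Qed.

Lemma deg0_notin H x : loopless H -> x \notin verts H -> deg H x = 0.
Proof.
move=> L xn; apply/eqP; rewrite -leqn0 leqNgt -has_count; apply/hasPn=> f fH.
by apply: contra xn; apply: incident_vert.
Qed.

Lemma count1_eq (T : eqType) (p : pred T) (s : seq T) x y :
  count p s = 1 -> x \in s -> p x -> y \in s -> p y -> x = y.
Proof.
rewrite -size_filter => S xs px ys py.
have : x \in filter p s by rewrite mem_filter px.
have : y \in filter p s by rewrite mem_filter py.
case: (filter p s) S => [//|z [|//]] _; by rewrite !inE => /eqP-> /eqP->.
Qed.

Lemma wf_kind_inj H e f :
  wf_graph H -> e \in edges H -> f \in edges H -> e.1 = f.1 -> e = f.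
Proof.
move/wf_uniq_kinds=> U eH fH E.
have C : count (fun g => ekind g == e.1) (edges H) = 1.
  by have := count_uniq_mem e.1 U; rewrite count_map => ->; rewrite (map_f ekind eH).
by apply: (count1_eq C) => //; rewrite /ekind E.
Qed.

Lemma count1P (T : eqType) (p : pred T) (s : seq T) x :
  uniq s -> x \in s -> p x -> (forall y, y \in s -> p y -> y = x) -> count p s = 1.
Proof.
move=> U xs px A.
rewrite (eq_in_count (a2 := pred1 x)) ?count_uniq_mem ?xs // => y ys /=.
by apply/idP/eqP => [/(A _ ys)|->].
Qed.

Lemma count2_eq (T : eqType) (p : pred T) (s : seq T) x y z :
  count p s = 2 -> x != y -> x \in s -> p x -> y \in s -> p y -> z \in s -> p z ->
  z = x \/ z = y.
Proof.
rewrite -size_filter => S N xs px ys py zs pz.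
have : x \in filter p s by rewrite mem_filter px.
have : y \in filter p s by rewrite mem_filter py.
have : z \in filter p s by rewrite mem_filter pz.
case: (filter p s) S => [//|a [//|b [|//]]] _; rewrite !inE.
by do 3![case/orP=> /eqP ?]; subst; auto; rewrite eqxx in N.
Qed.

Lemma count_gt1 (T : eqType) (p : pred T) (s : seq T) x :
  uniq s -> 1 < count p s -> exists y, [/\ y \in s, p y & y != x].
Proof.
move=> U C; case: (boolP (has (fun y => p y && (y != x)) s)).
  by case/hasP=> y ys /andP[py N]; exists y.
move/hasPn=> A; have : count p s <= count (pred1 x) s.
  rewrite -!size_filter; apply: uniq_leq_size; first exact: filter_uniq.
  move=> y; rewrite !mem_filter => /andP[py ys]; rewrite ys andbT /=.
  by move: (A _ ys); rewrite py /= negbK.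
rewrite count_uniq_mem //; case: (x \in s); lia.
Qed.

(** The two edges form a path whose only internal vertex is [x], closed when they are parallel. *)
Lemma same_class_at H u v x e f :
  loopless H -> x != u -> x != v -> e \in edges H -> f \in edges H ->
  incident e x -> incident f x -> same_class H u v e f.
Proof.
move=> L xu xv eH fH ie ie'.
have [y Jy] := incident_joins ie; have [z Jz] := incident_joins ie'.
have xy := joins_neq L eH Jy; have xz := joins_neq L fH Jz.
case: (eqVneq e f) => [<-|N].
  exists x, [:: (e, y)]; split; rewrite /= ?inE ?eqxx //.
  by split => //=; split=> //; left; rewrite inE xy.
exists y, [:: (e, x); (f, z)]; split; rewrite /= ?inE ?eqxx ?orbT //; try by rewrite eq_sym.
split; first by rewrite /= joinsC.
split; first by rewrite /= inE N.
have yx : y != x by rewrite eq_sym.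
case: (eqVneq y z) => [<-|yz]; [right|left]; first by rewrite /= inE xy.
by rewrite /= !inE negb_or yx yz xz.
Qed.

(* The shape of [sep_witness] that the proofs use: [P] is constant on the edges
   at every vertex other than [u] and [v]. *)
Record sides (H : graph) (u v : nat) (P : pred edge) : Prop := Sides {
  sides_u : u \in verts H;
  sides_v : v \in verts H;
  sides_neq : u != v;
  sides_const : forall x e f, x != u -> x != v -> e \in edges H -> f \in edges H ->
    incident e x -> incident f x -> P e = P f;
  sides_count : 1 < count P (edges H);
  sides_countC : 1 < count (predC P) (edges H) }.

Lemma sep_witness_sides H u v P : loopless H -> sep_witness H u v P -> sides H u v P.
Proof.
move=> L [[uH vH uv] A c1 c2]; split=> // x e f xu xv eH fH ie jf.
by apply: A => //; apply: same_class_at jf.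
Qed.

Lemma sidesC H u v P : sides H u v P -> sides H u v (predC P).
Proof.
case=> uH vH uv A c1 c2; split=> //.
  by move=> x e f xu xv eH fH ie jf /=; rewrite (A x e f).
by rewrite (eq_count (a2 := P)) // => e /=; rewrite negbK.
Qed.

Lemma sides_sym H u v P : sides H u v P -> sides H v u P.
Proof.
case=> uH vH uv A c1 c2; split=> //; first by rewrite eq_sym.
by move=> x e f xu xv; apply: A.
Qed.

Section Sides.
Variables (H : graph) (u v : nat).
Hypotheses (wfH : wf_graph H) (biH : biconnected H).
Let LH := wf_loopless wfH.

(** Follow a path from [w] to [u] that avoids [v]. As long as it stays off [u], consecutive edges
    meet outside the pair and hence lie on the same side, so the edge by which it enters [u] is
    still on the side of [g]. *)
Lemma side_reaches P w g :
  sides H u v P -> g \in edges H -> P g -> incident g w -> w != u -> w != v ->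
  exists f z, [/\ f \in edges H, P f, joins f u z, z != u & z != v].
Proof.
move=> S gH Pg iw wu wv; have [_ /(_ w u v)] := biH.
move=> /(_ (incident_vert LH gH iw) (sides_u S) (sides_v S) wu wv (sides_neq S)) R.
pose Q y := (exists f z, [/\ f \in edges H, P f, joins f u z, z != u & z != v]) \/
  [/\ y != u, y != v & exists2 h, h \in edges H & P h && incident h y].
suff: Q u by case=> // -[]; rewrite eqxx.
elim: R => [_ _|y f z _ IH fH _ J zv]; first by right; split=> //; exists g; rewrite ?Pg.
case: IH => [E|[yu yv [h hH /andP[Ph ih]]]]; first by left.
have Pf : P f by rewrite (sides_const S yu yv fH hH (joins_incidentl J) ih).
case: (eqVneq z u) => [E|zu].
  by left; exists f, y; split=> //; rewrite joinsC -E.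
by right; split=> //; exists f; rewrite ?Pf //= (joins_incidentr J).
Qed.

Lemma side_touch P : sides H u v P -> exists f, [/\ f \in edges H, P f & incident f u].
Proof.
move=> S; have /hasP[g gH Pg] : has P (edges H) by rewrite has_count; have := sides_count S; lia.
case: (boolP (incident g u)) => [iu|niu]; first by exists g.
have [w iw wv] := end_neq v LH gH.
have wu : w != u by apply: contraNneq niu => <-.
have [f [z [fH Pf J _ _]]] := side_reaches S gH Pg iw wu wv.
by exists f; split=> //; apply: joins_incidentl J.
Qed.

(** The side has a second edge, which is not at [u]. Following it towards [u] gives an edge of the
    side at [u] whose other end is not [v], and this edge can only be [e]. *)
Lemma lone_edge_far P e :
  sides H u v P -> (forall f, f \in edges H -> P f -> incident f u -> f = e) ->
  ~~ incident e v.
Proof.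
move=> S A; apply/negP=> iv.
have [g [gH Pg ge]] := count_gt1 e (wf_uniq_edges wfH) (sides_count S).
have niu : ~~ incident g u by apply: contra ge => iu; apply/eqP/A.
have [w iw wv] := end_neq v LH gH.
have wu : w != u by apply: contraNneq niu => <-.
have [f [z [fH Pf J zu zv]]] := side_reaches S gH Pg iw wu wv.
have E := A _ fH Pf (joins_incidentl J); subst f.
case: (joins_end J iv) => E; first by have := sides_neq S; rewrite E eqxx.
by rewrite E eqxx in zv.
Qed.

End Sides.

(** One form for both halves of a split: [Q] is [sP st] for [split_part1] and [predC (sP st)] for
    [split_part2], so that each fact is proved once and used for either side. *)
Definition part (H : graph) (u v n : nat) (Q : pred edge) : graph :=
  sub_graph (filter Q (edges H)) u v n.

Lemma edges_part H u v n Q f :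
  (f \in edges (part H u v n Q)) = (f == vedge n u v) || Q f && (f \in edges H).
Proof. by rewrite /part /sub_graph /edges /= mem_rcons inE mem_filter. Qed.

Lemma verts_part H u v n Q x :
  (x \in verts (part H u v n Q)) =
  [|| x == u, x == v | has (fun f => Q f && incident f x) (edges H)].
Proof.
have -> : verts (part H u v n Q) =
  undup (u :: v :: flatten [seq [:: eu f; ev f] | f <- filter Q (edges H)]) by [].
rewrite mem_undup !inE; do 2!congr orb.
apply/flatten_mapP/hasP => [[f]|[f fH /andP[Qf /orP[]/eqP<-]]].
- rewrite mem_filter => /andP[Qf fH]; rewrite !inE => xf; exists f => //.
  by rewrite Qf /incident !(eq_sym _ x).
- by exists f; rewrite ?mem_filter ?Qf ?inE ?eqxx.
- by exists f; rewrite ?mem_filter ?Qf ?inE ?eqxx ?orbT.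
Qed.

Lemma deg_part H u v n Q x :
  deg (part H u v n Q) x =
  count (fun f => Q f && incident f x) (edges H) + ((u == x) || (v == x)).
Proof.
rewrite /deg /part /sub_graph /edges /= -cats1 count_cat count_filter /= addn0.
by congr addn; apply: eq_count => f /=; rewrite andbC.
Qed.

Lemma deg_predC H (Q : pred edge) x :
  deg H x = count (fun f => Q f && incident f x) (edges H) +
            count (fun f => predC Q f && incident f x) (edges H).
Proof.
rewrite /deg; elim: (edges H) => //= f s ->.
by case: (Q f) => /=; lia.
Qed.

Lemma deg_part_out H u v n Q x e :
  sides H u v Q -> x != u -> x != v -> e \in edges H -> Q e -> incident e x ->
  deg (part H u v n Q) x = deg H x.
Proof.
move=> S xu xv eH Qe ie; rewrite deg_part !(eq_sym _ x) (negbTE xu) (negbTE xv) addn0.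
apply: eq_in_count => f fH /=; case: (boolP (incident f x)) => i; last by rewrite andbF.
by rewrite (sides_const S xu xv fH eH i ie) Qe.
Qed.

Lemma deg_part_in H u v n Q a :
  (a == u) || (a == v) ->
  deg (part H u v n Q) a = (count (fun f => Q f && incident f a) (edges H)).+1.
Proof. by rewrite deg_part !(eq_sym _ a) => ->; rewrite addn1. Qed.

Lemma wf_part H u v n Q :
  wf_graph H -> u \in verts H -> v \in verts H -> u != v -> n \notin labels_g H ->
  wf_graph (part H u v n Q).
Proof.
move=> W uH vH uv nn; split.
  exact: (undup_uniq (u :: v :: flatten [seq [:: eu f; ev f] | f <- filter Q (edges H)])).
split.
  rewrite /part /sub_graph /edges /= map_rcons rcons_uniq; apply/andP; split.
    apply/negP=> /mapP[f]; rewrite mem_filter => /andP[_ fH] E.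
    case/negP: nn; rewrite /labels_g mem_pmap; apply/mapP; exists f => //.
    by move: E; rewrite /ekind /= => <-.
  exact: subseq_uniq (map_subseq _ (filter_subseq _ _)) (wf_uniq_kinds W).
move=> f; rewrite edges_part => fH; rewrite !verts_part.
case/orP: fH => [/eqP->|/andP[Qf fH]]; first by rewrite /= !eqxx /= orbT.
have [_ /(_ _ fH) [_ _ N]] := wf_loopless W; split=> //.
  by apply/or3P/Or33/hasP; exists f => //; rewrite Qf /incident eqxx.
by apply/or3P/Or33/hasP; exists f => //; rewrite Qf /incident eqxx orbT.
Qed.

(** * Ears and 2.5-splits *)

(** Ears as classes of a relation: open and closed ears need no distinction, and a split can be
    followed link by link. The agreement with maximal paths is [on_earP]. *)
Inductive earc (H : graph) (e : edge) : edge -> Prop :=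
| earc_refl : e \in edges H -> earc H e e
| earc_step f g x : earc H e f -> g \in edges H -> incident f x -> incident g x ->
    deg H x = 2 -> earc H e g.

Lemma earc_edgel H e f : earc H e f -> e \in edges H.
Proof. by elim. Qed.

Lemma earc_edger H e f : earc H e f -> f \in edges H.
Proof. by case. Qed.

Lemma earc_trans H e f g : earc H e f -> earc H f g -> earc H e g.
Proof. move=> ef; elim=> // h k x _ IH kH ih ik d; exact: earc_step IH kH ih ik d. Qed.

Lemma earc_sym H e f : earc H e f -> earc H f e.
Proof.
elim=> [|g h x eg IH hH ig ih d]; first exact: earc_refl.
apply: earc_trans IH; apply: earc_step (earc_refl hH) (earc_edger eg) ih ig d.
Qed.

Lemma walk_edges H x0 p f : walk_ok H x0 p -> f \in map fst p -> f \in edges H.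
Proof.
elim: p x0 => // -[g y] p IH x0 /= [gH [_ W]]; rewrite inE => /orP[/eqP-> //|].
exact: IH W.
Qed.

(** Consecutive edges meet at an internal vertex, so a property handed over there holds for all
    edges of the walk or for none. It serves for ears as well as for separation classes. *)
Lemma walk_spread H (R : edge -> Prop) x0 p :
  walk_ok H x0 p ->
  (forall x f g, x \in internal x0 p -> f \in edges H -> g \in edges H ->
     incident f x -> incident g x -> R f -> R g) ->
  forall f g, f \in map fst p -> g \in map fst p -> R f -> R g.
Proof.
elim: p x0 => // -[f1 y] [|[f2 z] p] IH x0.
  by move=> _ _ f g; rewrite !inE => /eqP-> /eqP->.
move=> [f1H [J1 W]] A; have W' := W; case: W' => f2H [J2 _].
have i1 := joins_incidentr J1; have i2 := joins_incidentl J2.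
have {}IH := IH y W (fun x f g xi => A x f g (mem_behead (s := y :: _) xi)).
have yi : y \in internal x0 [:: (f1, y), (f2, z) & p] by rewrite /internal /= inE eqxx.
have f2p : f2 \in map fst ((f2, z) :: p) by rewrite inE eqxx.
move=> f g; rewrite [map _ _]/= !(in_cons f1) => /orP[/eqP->|fp] /orP[/eqP->|gp] // Rf.
- exact: (IH f2 g f2p gp (A y f1 f2 yi f1H f2H i1 i2 Rf)).
- exact: (A y f2 f1 yi f2H f1H i2 i1 (IH f f2 fp f2p Rf)).
- exact: (IH f g fp gp Rf).
Qed.

Lemma walk_rcons H x0 p f y :
  walk_ok H x0 (rcons p (f, y)) <->
  [/\ walk_ok H x0 p, f \in edges H & joins f (last x0 (map snd p)) y].
Proof.
elim: p x0 => [|[g z] p IH] x0 /=; first by split=> [[? []]|[]].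
by rewrite IH; split=> [[? [? []]]|[[? []]]].
Qed.

Lemma walk_incident H x0 p f x :
  walk_ok H x0 p -> f \in map fst p -> incident f x -> x \in x0 :: map snd p.
Proof.
elim: p x0 => // -[g y] p IH x0 /= [gH [J W]]; rewrite in_cons => /orP[/eqP->|fp] i.
  by case: (joins_end J i) => ->; rewrite !inE eqxx ?orbT.
by rewrite inE (IH y W fp i) orbT.
Qed.

Lemma internal_rcons x0 p a : internal x0 (rcons p a) = map snd p.
Proof. by rewrite /internal map_rcons belast_rcons. Qed.

Lemma path_vertP x0 (p : seq (edge * nat)) x :
  x \in x0 :: map snd p -> [\/ x = x0, x = last x0 (map snd p) | x \in internal x0 p].
Proof.
case/lastP: p => [|p a]; first by rewrite inE => /eqP; constructor 1.
rewrite internal_rcons map_rcons last_rcons inE mem_rcons inE.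
by case/or3P=> [/eqP|/eqP|]; [constructor 1|constructor 2|constructor 3].
Qed.

Lemma internal_two_edges H x0 p x :
  walk_ok H x0 p -> uniq (map fst p) -> x \in internal x0 p ->
  exists f g, [/\ f \in map fst p, g \in map fst p, f != g, incident f x & incident g x].
Proof.
elim: p x0 => // -[f y] [//|[g z] p] IH x0 [fH [J W]].
rewrite [map _ _]/= cons_uniq => /andP[nf U].
have -> : internal x0 [:: (f, y), (g, z) & p] = y :: internal y ((g, z) :: p) by [].
rewrite inE => /orP[/eqP->|xi].
  exists f, g; rewrite !inE !eqxx ?orbT; split=> //.
  - by apply: contraNneq nf => ->; rewrite inE eqxx.
  - exact: joins_incidentr J.
  - by case: W => _ [/joins_incidentl].
have [h [k [hp kp N ih ik]]] := IH y W U xi.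
by exists h, k; rewrite inE hp inE kp !orbT.
Qed.

(** Provides a longest path. The existence of a path of given length is a mere proposition here,
    hence the classical case distinction. *)
Lemma bounded_max (P : nat -> Prop) b n :
  P n -> (forall m, P m -> m <= b) -> exists2 m, P m & forall k, P k -> k <= m.
Proof.
move=> Pn B; have [k] := ubnP (b - n); elim: k n Pn => // k IH n Pn lk.
case: (classic (exists2 m, P m & n < m)) => [[m Pm nm]|N].
  by apply: (IH m) => //; have := B _ Pm; lia.
by exists n => // m Pm; rewrite leqNgt; apply/negP=> nm; apply: N; exists m.
Qed.

Lemma path_size H x0 p : is_path H x0 p -> size p <= size (edges H).
Proof.
case=> W [U _]; rewrite -(size_map fst); apply: uniq_leq_size U _ => f.
exact: walk_edges W.
Qed.

Section Ears.
Variable H : graph.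
Hypothesis wfH : wf_graph H.
Let LH := wf_loopless wfH.

Lemma deg2_edges x f g h :
  deg H x = 2 -> f != g -> f \in edges H -> g \in edges H -> h \in edges H ->
  incident f x -> incident g x -> incident h x -> h = f \/ h = g.
Proof. by move=> d N fH gH hH *; apply: (count2_eq (p := fun f => incident f x) d N). Qed.

Definition deg2_path e x0 p := [/\ is_path H x0 p, e \in map fst p & deg2_internal H x0 p].

(* A missing edge [g] at a degree-2 vertex of a longest path would extend it. *)
Lemma longest_deg2_path_closed e x0 p f g x :
  deg2_path e x0 p -> (forall y0 q, deg2_path e y0 q -> size q <= size p) ->
  f \in map fst p -> g \in edges H -> incident f x -> incident g x -> deg H x = 2 ->
  g \in map fst p.
Proof.
move=> [[W [U V]] ep D] M fp gH jf ig dx; apply/negPn/negP=> gp.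
(* Two distinct edges of the path at a vertex of degree 2 exhaust it, leaving no room for [g]. In
   particular [g] touches no internal vertex. *)
have two h k y : h \in map fst p -> k \in map fst p -> h != k -> deg H y = 2 ->
    incident h y -> incident k y -> incident g y -> False.
  move=> hp kp N dy ih ik iy; case/negP: gp.
  by case: (deg2_edges dy N (walk_edges W hp) (walk_edges W kp) gH ih ik iy) => ->.
have ni y : incident g y -> y \notin internal x0 p.
  move=> iy; apply/negP=> yi; have [h [k [hp kp N ih ik]]] := internal_two_edges W U yi.
  by apply: two N _ ih ik iy => //; apply/eqP; exact: (allP D).
have [y J] := incident_joins ig; have xy := joins_neq LH gH J.
have iy := joins_incidentr J.
have xp := walk_incident W fp jf.
(* On a closed path [x] must be the base point, where the first and the last edge already give two
   distinct edges; a closed path of one edge would be a loop. *)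
case: V => [V|[E V]]; last first.
  have {xp} E' : x = x0.
    by case: (path_vertP xp) => [->|->|xi] //; case/negP: (ni _ ig).
  subst x; case: p W U V E ep D M fp gp two ni => // -[f1 y1] p.
  case/lastP: p => [|p [f2 z]] W U V E ep D M fp gp two ni.
    case: W => f1H [J1 _]; have := joins_neq LH f1H J1.
    by move: E => /= ->; rewrite eqxx.
  move: (W); rewrite -rcons_cons => /walk_rcons [_ _ J2].
  case: (W) => _ [J1 _].
  have zE : z = x0 by move: E; rewrite -rcons_cons map_rcons last_rcons.
  apply: (two f1 f2 x0) => //; rewrite ?map_rcons /= ?map_rcons ?inE ?mem_rcons ?inE ?eqxx ?orbT //.
  - by move: U; rewrite /= map_rcons mem_rcons inE negb_or => /andP[/andP[]].
  - exact: joins_incidentl J1.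
  - by rewrite -zE; apply: joins_incidentr J2.
have pn : p != [::] by case: (p) ep.
(* On an open path [x] is an end, and [g] can be attached there. The longer path is closed if the
   far end [y] of [g] is the opposite end of [p]. *)
have [E|E] : x = x0 \/ x = last x0 (map snd p).
  by case: (path_vertP xp) => [->|->|xi]; auto; case/negP: (ni _ ig).
- subst x; suff /M : deg2_path e y ((g, x0) :: p) by rewrite /= ltnn.
  split; last 2 first.
  + by rewrite inE ep orbT.
  + have -> : deg2_internal H y ((g, x0) :: p) =
      all (fun x => deg H x == 2) (belast x0 (map snd p)) by [].
    move: D; rewrite /deg2_internal /internal; case: (p) pn => // a q _ /= ->.
    by rewrite dx.
  split; first by rewrite /= gH joinsC.
  split; first by rewrite [map _ _]/= cons_uniq gp.
  case: (boolP (y \in x0 :: map snd p)) => [yp|yp]; last by left; rewrite /= yp.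
  right; split=> //; rewrite /=; case: (path_vertP yp) => // [yE|yi].
    by rewrite yE eqxx in xy.
  by case/negP: (ni _ iy).
- suff /M : deg2_path e x0 (rcons p (g, y)) by rewrite size_rcons ltnn.
  split; last 2 first.
  + by rewrite map_rcons mem_rcons inE ep orbT.
  + rewrite /deg2_internal internal_rcons; case/lastP: (p) pn D E => [//|q a] _.
    rewrite /deg2_internal internal_rcons map_rcons all_rcons last_rcons => -> E.
    by rewrite -E dx.
  split; first by apply/walk_rcons; rewrite -E.
  split; first by rewrite map_rcons rcons_uniq gp.
  rewrite map_rcons; case: (boolP (y \in x0 :: map snd p)) => [yp|yp].
    right; rewrite last_rcons rcons_uniq.
    case: (path_vertP yp) => [yE|yE|yi]; last by case/negP: (ni _ iy).
      by rewrite yE; split=> //; move: V; rewrite /=.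
    by rewrite E -yE eqxx in xy.
  by left; rewrite -rcons_cons rcons_uniq yp.
Qed.

Lemma deg2_path_earc e x0 p f : deg2_path e x0 p -> f \in map fst p -> earc H e f.
Proof.
move=> [[W [U V]] ep D] fp.
apply: (walk_spread (R := earc H e) W _ ep fp); last exact/earc_refl/(walk_edges W).
move=> x g h xi gH hH ig ih eg; apply: earc_step eg hH ig ih _.
by apply/eqP; exact: (allP D).
Qed.

(** A longest path through [e] with interior vertices of degree 2 contains the whole class of [e],
    and any other such path stays inside that class. Greatest length therefore gives the maximality
    under inclusion that [is_ear] asks for. *)
Lemma ear_exists e : e \in edges H ->
  exists x0 p, is_ear H e x0 p /\ forall f, earc H e f -> f \in map fst p.
Proof.
move=> eH.
have [x1 [p1 D1]] : exists x0 p, deg2_path e x0 p.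
  have J : joins e (eu e) (ev e) by rewrite /joins !eqxx.
  exists (eu e), [:: (e, ev e)]; split; rewrite ?inE //; split=> //; split=> //.
  by left; rewrite /= inE (joins_neq LH eH J).
have [m [x0 [p [D <-]]] M] := @bounded_max
  (fun m => exists x0 p, deg2_path e x0 p /\ size p = m) (size (edges H)) (size p1)
  (ex_intro _ x1 (ex_intro _ p1 (conj D1 erefl)))
  ltac:(by move=> _ [y [q [[Dq _ _] <-]]]; exact: path_size Dq).
have cl f : earc H e f -> f \in map fst p.
  elim=> [_|g h x _ gp hH ig ih dx]; first by case: D.
  by apply: longest_deg2_path_closed D _ gp hH ig ih dx => y0 q Dq; apply: M; exists y0, q.
exists x0, p; split=> //; case: (D) => P ep DD; split=> // y0 q Pq eq Dq f fq.
by apply: cl; apply: (deg2_path_earc (p := q) (x0 := y0)).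
Qed.

Lemma on_earP e l : e \in edges H ->
  on_ear H e l <-> exists2 f, earc H e f & f.1 = inr l.
Proof.
move=> eH; split=> [[x0 [p [[P ep D _] /mapP[f fp E]]]]|[f ef E]].
  by exists f => //; apply: (deg2_path_earc (p := p) (x0 := x0)).
have [x0 [p [E' cl]]] := ear_exists eH.
exists x0, p; split=> //; apply/mapP; exists f => //; exact: cl.
Qed.

End Ears.

Section PartEars.
Variables (H : graph) (u v n : nat) (Q : pred edge).
Hypotheses (S : sides H u v Q) (du : deg H u <> 2) (dv : deg H v <> 2).
Let Pt := part H u v n Q.
Let enew := vedge n u v.

Lemma vedge_in_part : enew \in edges Pt.
Proof. by rewrite edges_part eqxx. Qed.

(** Since neither [u] nor [v] has degree 2, no link of an ear is at the pair. The ear thus lies on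
    one side, where the degrees at its links are unchanged. *)
Lemma earc_part e g : earc H e g -> Q e -> Q g /\ earc Pt e g.
Proof.
move=> A Qe; elim: A => [eH|f h x A [Qf IH] hH jf ih dx].
  by split=> //; apply: earc_refl; rewrite edges_part Qe eH orbT.
have xu : x != u by apply/eqP=> E; apply: du; rewrite -E.
have xv : x != v by apply/eqP=> E; apply: dv; rewrite -E.
have fH := earc_edger A.
have Qh : Q h by rewrite (sides_const S xu xv hH fH ih jf).
split=> //; apply: earc_step IH _ (jf) ih _; first by rewrite edges_part Qh hH orbT.
by rewrite (deg_part_out n S xu xv fH Qf jf).
Qed.

(** A chain in the part is a chain of [H] until it links at [u] or [v]. That vertex then has degree
    2 in the part and is an end of the new edge, so the chain belongs to the ear of the new edge. *)
Lemma earc_part_old e g :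
  earc Pt e g -> e \in edges H -> Q e -> earc H e g \/ earc Pt enew e.
Proof.
move=> A eH Qe; elim: A => [_|f h x A IH hP jf ih dx]; first by left; apply: earc_refl.
case: IH => [ef|]; last by right.
have [Qf _] := earc_part ef Qe.
case: (boolP ((x == u) || (x == v))) => [xuv|].
  right; apply: earc_sym; apply: earc_step A vedge_in_part jf _ dx.
  by rewrite /incident /= !(eq_sym _ x).
rewrite negb_or => /andP[xu xv].
move: hP; rewrite edges_part => /orP[/eqP E|/andP[Qh hH]].
  by move: ih; rewrite E /incident /= !(eq_sym _ x) (negbTE xu) (negbTE xv).
left; apply: earc_step ef (hH) jf (ih) _.
by rewrite -(deg_part_out n S xu xv hH Qh ih).
Qed.

(** Take the last link of the chain at a vertex [a] of the pair and let [e] be the edge used there;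
    from [e] on, the chain runs in [H]. *)
Lemma earc_part_new g :
  earc Pt enew g -> g = enew \/
  exists a e, [/\ (a == u) || (a == v), deg Pt a = 2, Q e, incident e a & earc H e g].
Proof.
elim=> [_|f h x A IH hP jf ih dx]; first by left.
move: hP; rewrite edges_part => /orP[/eqP E|/andP[Qh hH]]; first by left.
right; case: (boolP ((x == u) || (x == v))) => [xuv|].
  by exists x, h; split=> //; apply: earc_refl.
move=> xuv; case: IH => [E|[a [e [auv da Qe ie ef]]]].
  by case/negP: xuv; move: jf; rewrite E /incident /= !(eq_sym x).
move: xuv; rewrite negb_or => /andP[xu xv].
exists a, e; split=> //; apply: earc_step ef (hH) jf (ih) _.
by rewrite -(deg_part_out n S xu xv hH Qh ih).
Qed.

End PartEars.

(** * Vertex-edge-separators in terms of degrees *)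

Lemma reach_sym H okv oke x y :
  loopless H -> reach H okv oke x y -> reach H okv oke y x.
Proof.
move=> L; elim=> [xH ox|z f t R IH fH ok J ot]; first exact: reach_refl.
apply: reach_trans IH; apply: (@reach_step _ _ _ t t f) => //.
- by apply: reach_refl => //; apply: incident_vert fH (joins_incidentr J).
- by rewrite joinsC.
- exact: reach_ok R.
Qed.

Section TwoFive.
Variables (H : graph) (a c : nat) (Q : pred edge) (e : edge).
Hypotheses (wfH : wf_graph H) (biH : biconnected H).
Let LH := wf_loopless wfH.

Lemma edge_in_HaP f :
  edge_in_Ha H c e a f <-> forall y, incident f y -> in_Ha H c e a y.
Proof.
split=> [[iu iv] y /orP[]/eqP<- //|A].
by split; apply: A; rewrite /incident eqxx ?orbT.
Qed.

(** If the other end [b] of [e] could be reached from [a] without [e] and [c], then [e] could be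
    bypassed in [H - c], which is connected, and nothing would be separated. So [e] is outside
    [H_a], whereas every other edge at [a] leads into [H_a]. *)
Lemma vesep_lone_edge :
  vesep H c e -> incident e a -> (forall f, f \in edges H -> ~~ Q f <-> edge_in_Ha H c e a f) ->
  Q e /\ forall f, f \in edges H -> Q f -> incident f a -> f = e.
Proof.
move=> [[_ cH eH cu cv] [x [y [xH yH xc yc nr]]]] ie A.
have nc z : incident e z -> z != c by case/orP=> /eqP<-; rewrite eq_sym.
have aH := incident_vert LH eH ie.
have [b J] := incident_joins ie.
have nab : ~ reach H (fun z => z != c) (fun f => f != e) a b.
  move=> rab; apply: nr.
  have : reach H (fun z => z != c) predT x y.
    case: (eqVneq x y) => [<-|xy]; first exact: reach_refl.
    by case: biH => _; apply.
  elim=> [//|s f t _ IH fH _ Jf tc]; first exact: reach_refl.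
  case: (eqVneq f e) => [E|fe]; last exact: reach_step IH fH fe Jf tc.
  subst f; apply: reach_trans IH _.
  have st := joins_neq LH fH Jf.
  case: (joins_end J (joins_incidentl Jf)) => sE; case: (joins_end J (joins_incidentr Jf)) => tE;
    subst s t; rewrite ?eqxx // in st *.
  exact: reach_sym rab.
split.
  apply/negPn/negP=> /(A _ eH) /edge_in_HaP /(_ b (joins_incidentr J)) [E|//].
  by have := nc _ (joins_incidentr J); rewrite E eqxx.
move=> f fH Qf jf; apply/eqP/negPn/negP=> fe.
suff /(A _ fH) : edge_in_Ha H c e a f by rewrite Qf.
have [z Jz] := incident_joins jf.
have ra : reach H (fun z => z != c) (fun f => f != e) a a.
  by apply: reach_refl => //; apply: nc.
apply/edge_in_HaP=> y' iy; case: (joins_end Jz iy) => ->; first by right.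
case: (eqVneq z c) => [->|zc]; first by left.
by right; apply: reach_step ra fH fe Jz zc.
Qed.

Hypotheses (S : sides H a c Q) (eH : e \in edges H) (Qe : Q e) (ie : incident e a).
Hypothesis lone : forall f, f \in edges H -> Q f -> incident f a -> f = e.

Let nic : ~~ incident e c := lone_edge_far wfH biH S lone.

(** Without [e] no edge of the side [Q] is left at [a], and the other way into that side, [c], is
    forbidden. *)
Lemma lone_reach_side y :
  reach H (fun z => z != c) (fun f => f != e) a y ->
  y = a \/ [/\ y != a, y != c & exists2 h, h \in edges H & ~~ Q h && incident h y].
Proof.
elim=> [_ _|z f t _ IH fH fe J tc]; first by left.
case: (eqVneq t a) => [|ta]; [by left|right; split=> //].
suff nQf : ~~ Q f by exists f; rewrite ?nQf //= (joins_incidentr J).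
case: IH => [E|[za zc [h hH /andP[nQh ih]]]].
  by apply: contra fe => Qf; apply/eqP/lone => //; rewrite -E (joins_incidentl J).
by rewrite (sides_const S za zc fH hH (joins_incidentl J) ih).
Qed.

(** Removing [e] and [c] separates [a] from the other end of [e]; the bound on the number of edges
    rules out the triangle, which [vesep] exempts. *)
Lemma lone_vesep : 3 < size (edges H) -> vesep H c e.
Proof.
move=> sz; split.
  split=> //; first by case=> _ E; rewrite E in sz.
  - exact: sides_v S.
  - by apply: contraNneq nic => ->; rewrite /incident eqxx.
  - by apply: contraNneq nic => ->; rewrite /incident eqxx orbT.
have [b J] := incident_joins ie; have ab := joins_neq LH eH J.
have bc : b != c by apply: contraNneq nic => <-; apply: joins_incidentr J.
exists a, b; split=> //.
- exact: sides_u S.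
- exact: incident_vert eH (joins_incidentr J).
- exact: sides_neq S.
case/lone_reach_side=> [E|[ba _ [h hH /andP[nQh ih]]]]; first by rewrite E eqxx in ab.
by rewrite (sides_const S ba bc hH eH ih (joins_incidentr J)) Qe in nQh.
Qed.

Lemma lone_side_Ha f : f \in edges H -> ~~ Q f <-> edge_in_Ha H c e a f.
Proof.
move=> fH; rewrite edge_in_HaP; split=> [nQf y iy|A].
  have aH := sides_u S; have ac := sides_neq S.
  case: (eqVneq y c) => [->|yc]; first by left.
  case: (eqVneq y a) => [->|ya]; first by right; apply: reach_refl.
  have yH := incident_vert LH fH iy; right.
  have R : reach H (fun z => z != c) predT a y.
    by case: biH => _; apply=> //; [exact: sides_v S | rewrite eq_sym].
  (* A path from [a] that avoids [c] may wander into the side [Q], but it can come back only through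
     [a]; its vertices on the opposite side are therefore reached without [e]. *)
  suff : forall z, reach H (fun z => z != c) predT a z ->
      [\/ z = a, [/\ z != a, z != c & exists2 h, h \in edges H & Q h && incident h z]
        | reach H (fun z => z != c) (fun f => f != e) a z].
    move=> /(_ _ R) [E|[_ _ [h hH /andP[Qh ih]]]|//]; first by rewrite E eqxx in ya.
    by rewrite (sides_const S ya yc fH hH iy ih) Qh in nQf.
  move=> z; elim=> [_ _|{R} s g t R IH gH _ J tc]; first by constructor 1.
  case: (eqVneq t a) => [|ta]; first by constructor 1.
  case: (boolP (Q g)) => Qg.
    by constructor 2; split=> //; exists g; rewrite ?Qg //= (joins_incidentr J).
  have ge : g != e by apply: contraNneq Qg => ->.
  constructor 3; case: IH => [E|[sa sc [h hH /andP[Qh ih]]]|R'].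
  - by subst s; apply: reach_step (reach_refl _ aH ac) gH ge J tc.
  - by rewrite (sides_const S sa sc gH hH (joins_incidentl J) ih) Qh in Qg.
  - exact: reach_step R' gH ge J tc.
(* An edge of the side [Q] inside [H_a] would have both ends in [a] and [c]. Being at [a] it is [e],
   which does not touch [c]. *)
apply/negP=> Qf.
have K y : incident f y -> y = a \/ y = c.
  move=> iy; case: (A _ iy) => [|/lone_reach_side [|[ya yc [h hH /andP[nQh ih]]]]]; auto.
  by rewrite (sides_const S ya yc hH fH ih iy) Qf in nQh.
have [y iy yc] := end_neq c LH fH; case: (K _ iy) => E; subst y; last by rewrite eqxx in yc.
have fE := lone fH Qf iy.
have [y jy ya] := end_neq a LH fH; case: (K _ jy) => E; subst y; first by rewrite eqxx in ya.
by case/negP: nic; rewrite -fE.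
Qed.

End TwoFive.

(** Here [a] and [c] are the support in either order. The count is one below the degree of [a] in
    the part [Q], where the new edge is added. *)
Definition lone_edge (H : graph) (u v : nat) (Q : pred edge) (a c : nat) (e : edge) : Prop :=
  [/\ (a = u /\ c = v) \/ (a = v /\ c = u), e \in edges H, Q e, incident e a &
      count (fun f => Q f && incident f a) (edges H) = 1].

(** Trades the connectivity in the definition of a 2.5-split for a local count. The side [Q] is the
    one containing [e]; its complement consists of the edges of [H_a]. *)
Lemma twofiveP H st c e :
  wf_graph H -> biconnected H -> sides H (su st) (sv st) (sP st) ->
  twofive H st c e <->
  exists Q a, (Q = sP st \/ Q = predC (sP st)) /\ lone_edge H (su st) (sv st) Q a c e.
Proof.
move=> W B S; have U := wf_uniq_edges W; split.
  move=> [V [a [ea _ auv A]]]; have ie : incident e a by rewrite /incident !(eq_sym _ a).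
  have [Q [QP AQ]] : exists Q, (Q = sP st \/ Q = predC (sP st)) /\
      forall f, f \in edges H -> ~~ Q f <-> edge_in_Ha H c e a f.
    case: A => A; [exists (predC (sP st))|exists (sP st)]; split=> //; auto => f fH.
    by rewrite /= negbK; apply: A.
  have [Qe lone] := vesep_lone_edge W B V ie AQ.
  have eH : e \in edges H by case: V => [[]].
  exists Q, a; split=> //; split=> //; first by case: auv => [[<- <-]|[<- <-]]; auto.
  by apply: (count1P U eH); rewrite ?Qe ?ie // => y yH /andP[]; apply: lone.
move=> [Q [a [QP [auv eH Qe ie C1]]]].
have SQ : sides H a c Q.
  have : sides H (su st) (sv st) Q by case: QP => ->; rewrite //; apply: sidesC.
  by case: auv => [[-> ->]|[-> ->]] // /sides_sym.
have lone f : f \in edges H -> Q f -> incident f a -> f = e.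
  by move=> fH Qf jf; apply: (count1_eq C1) => //; rewrite ?Qf ?Qe.
(* Each side has at least two edges. *)
have sz : 3 < size (edges H).
  by rewrite -(count_predC Q); have := sides_count SQ; have := sides_countC SQ; lia.
have AQ f := lone_side_Ha W B SQ Qe lone (f := f).
split; first exact: lone_vesep W B SQ eH Qe ie lone sz.
exists a; split.
- by move: ie; rewrite /incident !(eq_sym _ a).
- have /hasP[f1 f1H q1] : has (predC Q) (edges H).
    by rewrite has_count; have := sides_countC SQ; lia.
  have [f2 [f2H q2 N]] := count_gt1 f1 U (sides_countC SQ).
  by exists f1, f2; split=> //; [rewrite eq_sym | apply/AQ | apply/AQ].
- by case: auv => [[-> ->]|[-> ->]]; auto.
- case: QP => E; [right|left] => f /AQ; rewrite E //=; by rewrite negbK.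
Qed.

(** * Collections obtained by splits *)

Lemma labels_gP H l : reflect (exists2 f, f \in edges H & f.1 = inr l) (l \in labels_g H).
Proof.
rewrite /labels_g mem_pmap; apply: (iffP mapP) => [[f fH]|[f fH E]].
  by case E: f.1 => [//|k] [->]; exists f.
by exists f => //; rewrite E.
Qed.

Lemma labelsP C l :
  l \in labels C <-> exists H f, [/\ H \in C, f \in edges H & f.1 = inr l].
Proof.
split=> [/flatten_mapP[H HC /labels_gP[f fH E]]|[H [f [HC fH E]]]]; first by exists H, f.
by apply/flatten_mapP; exists H => //; apply/labels_gP; exists f.
Qed.

Lemma count_filter_predC (T : Type) (p Q : pred T) (s : seq T) :
  count p (filter Q s) + count p (filter (predC Q) s) = count p s.
Proof. by elim: s => //= x s <-; case: (Q x) => /=; lia. Qed.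

Section PartShape.
Variables (H : graph) (u v n : nat) (Q : pred edge).
Hypotheses (wfH : wf_graph H) (S : sides H u v Q).
Let LH := wf_loopless wfH.
Let Pt := part H u v n Q.

Lemma part_verts_sub x : x \in verts Pt -> x \in verts H.
Proof.
rewrite verts_part => /or3P[/eqP->|/eqP->|/hasP[f fH /andP[_ i]]].
- exact: sides_u S.
- exact: sides_v S.
- exact: incident_vert fH i.
Qed.

Lemma part_side_vert x f :
  x != u -> x != v -> x \in verts Pt -> f \in edges H -> incident f x -> Q f.
Proof.
move=> xu xv; rewrite verts_part (negbTE xu) (negbTE xv) /= => /hasP[h hH /andP[Qh ih]] fH jf.
by rewrite (sides_const S xu xv fH hH jf ih).
Qed.

(* An excursion of the path into the other side is shortcut along the new edge. *)
Lemma reach_part okv p q :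
  p \in verts Pt -> q \in verts Pt -> reach H okv predT p q -> reach Pt okv predT p q.
Proof.
move=> pP qP R.
have enP : vedge n u v \in edges Pt by rewrite edges_part eqxx.
have J1 : joins (vedge n u v) u v by rewrite /joins !eqxx.
have J2 : joins (vedge n u v) v u by rewrite joinsC.
(* Outside the part, [T] remembers the vertex [a] of the pair through which the path left. On its
   return the path is at [a] again or at the other end of the new edge. *)
pose T y := (y \in verts Pt /\ reach Pt okv predT p y) \/
  [/\ y != u, y != v, (exists2 h, h \in edges H & ~~ Q h && incident h y) &
      exists2 a, (a == u) || (a == v) & reach Pt okv predT p a].
suff: T q.
  case=> [[]//|[qu qv [h hH /andP[nQ ih]] _]].
  by rewrite (part_side_vert qu qv qP hH ih) in nQ.
elim: R => [_ ok|y f z _ IH fH _ J oz]; first by left; split=> //; apply: reach_refl.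
have yz := joins_neq LH fH J.
have [iy iz] := (joins_incidentl J, joins_incidentr J).
case: (boolP (Q f)) => Qf.
  case: IH => [[yP R]|[yu yv [h hH /andP[nQ ih]] _]]; last first.
    by rewrite (sides_const S yu yv hH fH ih iy) Qf in nQ.
  left; split; first by rewrite verts_part; apply/or3P/Or33/hasP; exists f; rewrite ?Qf.
  by apply: reach_step R _ _ J oz => //; rewrite edges_part Qf fH orbT.
have [a auv R] : exists2 a, (a == u) || (a == v) & reach Pt okv predT p a.
  case: IH => [[yP R]|[yu yv _ //]]; exists y => //.
  apply/negPn/negP; rewrite negb_or => /andP[yu yv].
  by rewrite (part_side_vert yu yv yP fH iy) in Qf.
case: (boolP ((z == u) || (z == v))) => [zuv|]; last first.
  rewrite negb_or => /andP[zu zv]; right; split=> //; last by exists a.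
  by exists f; rewrite ?Qf.
left; split; first by rewrite verts_part; case/orP: zuv => ->; rewrite ?orbT.
case: (eqVneq a z) => [<- //|az].
apply: reach_step R enP isT _ oz.
by case/orP: auv => /eqP E; case/orP: zuv => /eqP F; subst a z; rewrite ?eqxx // in az.
Qed.

Lemma biconnected_part : biconnected H -> biconnected Pt.
Proof.
case=> c b; split=> [x y xP yP|x y w xP yP wP xy xw yw].
  by apply: reach_part => //; apply: c; apply: part_verts_sub.
by apply: reach_part => //; apply: b => //; apply: part_verts_sub.
Qed.

Lemma size_edges_part : 2 < size (edges Pt).
Proof.
rewrite /Pt /part /sub_graph /edges /= size_rcons size_filter.
exact: sides_count S.
Qed.

Lemma uniq_verts_part : uniq (verts Pt).
Proof. exact: (undup_uniq (u :: v :: flatten [seq [:: eu f; ev f] | f <- filter Q (edges H)])). Qed.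

Lemma size_verts_count : size (verts Pt) = count (fun x => x \in verts Pt) (verts H).
Proof.
rewrite -size_filter; apply: perm_size; apply: uniq_perm; first exact: uniq_verts_part.
  by apply: filter_uniq; case: LH.
move=> x; rewrite mem_filter; case: (boolP (x \in verts Pt)) => //= xP.
by rewrite (part_verts_sub xP).
Qed.

End PartShape.

(** Every vertex has an edge by connectedness, so the parts cover all vertices; they share exactly
    [u] and [v]. Hence a split adds two vertices and one graph, which is the conservation law in
    [si_verts]. *)
Lemma size_verts_parts H u v n Q :
  wf_graph H -> biconnected H -> sides H u v Q ->
  size (verts (part H u v n Q)) + size (verts (part H u v n (predC Q))) = size (verts H) + 2.
Proof.
move=> W [c _] S; have SC := sidesC S; have [U _] := wf_loopless W.
rewrite (size_verts_count n W S) (size_verts_count n W SC) -count_predUI; congr addn.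
  rewrite -[RHS]count_predT; apply: eq_in_count => x xH /=.
  rewrite (verts_part H u v n Q) (verts_part H u v n (predC Q)).
  case: (eqVneq x u) => //= xu; case: (eqVneq x v) => //= xv.
  have ux : u != x by rewrite eq_sym.
  have [f fH i] := reach_edge_incident (c u x (sides_u S) xH) ux.
  case: (boolP (Q f)) => Qf; apply/orP; [left|right]; apply/hasP; exists f => //=;
    by rewrite Qf.
rewrite -size_filter; apply: (@perm_size _ _ [:: u; v]); apply: uniq_perm.
- exact: filter_uniq.
- by rewrite /= inE (sides_neq S).
move=> x; rewrite mem_filter !inE /= (verts_part H u v n Q) (verts_part H u v n (predC Q)).
case: (eqVneq x u) => [->|xu] /=; first by rewrite (sides_u S).
case: (eqVneq x v) => [->|xv] /=; first by rewrite (sides_v S).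
apply/negP=> /andP[/andP[/hasP[f fH /andP[Qf jf]] /hasP[g gH /andP[nQ ig]]] _].
by move: nQ; rewrite /= (sides_const S xu xv gH fH ig jf) Qf.
Qed.

Lemma split_ok_perm C st C' :
  split_ok C st C' ->
  let H := nth g0 C (sidx st) in
  exists D, perm_eq C (H :: D) /\
    perm_eq C' (part H (su st) (sv st) (sl st) (sP st) ::
                part H (su st) (sv st) (sl st) (predC (sP st)) :: D).
Proof.
move=> [i _ _ _ ->] H; exists (take (sidx st) C ++ drop (sidx st).+1 C).
split; apply/permP=> a; last first.
  by rewrite count_cat /= count_cat addnCA; congr addn; rewrite addnCA.
rewrite -{1}(cat_take_drop (sidx st) C) (drop_nth g0 i) /= !count_cat /=.
by rewrite addnCA.
Qed.

Definition nlabel (l : nat) (H : graph) : nat := count (fun f => f.1 == inr l) (edges H).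
Definition sum_over (F : graph -> nat) (C : seq graph) : nat := sumn (map F C).

Lemma perm_sum_over F C C' : perm_eq C C' -> sum_over F C = sum_over F C'.
Proof. by move=> p; apply/perm_sumn/perm_map. Qed.

Lemma sum_over0 F C : (forall K, K \in C -> F K = 0) -> sum_over F C = 0.
Proof.
elim: C => // K C IH A; rewrite /sum_over /= A ?mem_head // add0n.
by apply: IH => L LC; apply: A; rewrite inE LC orbT.
Qed.

Lemma nlabel0 l H : (forall f, f \in edges H -> f.1 <> inr l) -> nlabel l H = 0.
Proof.
move=> A; apply/eqP; rewrite -leqn0 leqNgt -has_count.
by apply/negP=> /hasP[f fH /eqP /(A _ fH)].
Qed.

Lemma nlabel_parts l H u v n Q :
  nlabel l (part H u v n Q) + nlabel l (part H u v n (predC Q)) =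
  nlabel l H + (n == l).*2.
Proof.
rewrite /nlabel /part /sub_graph /edges /= -!cats1 !count_cat /=.
have -> : (inr n == inr l :> nat + nat) = (n == l) by [].
by rewrite addnACA !addn0 addnn count_filter_predC.
Qed.

(** [N] is the order of the initial graph. In [si_ends] the ends agree even as ordered pairs,
    because both copies of a virtual edge are created as the same [vedge]. The guard in [si_edges]
    is there because the initial graph may have fewer than three edges, while every part has at
    least three. *)
Record split_inv (N : nat) (C : seq graph) : Prop := SplitInv {
  si_wf : forall H, H \in C -> wf_graph H;
  si_bi : forall H, H \in C -> biconnected H;
  si_ends : forall H K f g l, H \in C -> K \in C -> f \in edges H -> g \in edges K ->
    f.1 = inr l -> g.1 = inr l -> f.2 = g.2;
  si_label : forall l, sum_over (nlabel l) C <= 2;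
  si_verts : sum_over (size \o verts) C + 2 = N + (size C).*2;
  si_edges : 1 < size C -> forall H, H \in C -> 2 < size (edges H) }.

Lemma split_inv_step N C st C' : split_inv N C -> split_ok C st C' -> split_inv N C'.
Proof.
move=> I O; have [D [P P']] := split_ok_perm O.
case: O => i B SW nl _; move: P P' B SW.
set H := nth _ _ _; set u := su st; set v := sv st; set n := sl st; set Q := sP st => P P' B SW.
have HC : H \in C by rewrite (perm_mem P) inE eqxx.
have DC K : K \in D -> K \in C by move=> KD; rewrite (perm_mem P) inE KD orbT.
have W := si_wf I HC; have S := sep_witness_sides (wf_loopless W) SW.
have nH : n \notin labels_g H.
  by apply: contra nl => /labels_gP[f fH E]; apply/labelsP; exists H, f.
have C'P K : K \in C' -> (exists2 R, sides H u v R & K = part H u v n R) \/ K \in D.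
  rewrite (perm_mem P') !inE => /or3P[/eqP->|/eqP->|]; auto; left; first by exists Q.
  by exists (predC Q) => //; apply: sidesC.
have eP K f : K \in C' -> f \in edges K ->
    f = vedge n u v \/ exists2 L, L \in C & f \in edges L.
  case/C'P=> [[R _ ->]|KD fK]; last by right; exists K => //; apply: DC.
  by rewrite edges_part => /orP[/eqP->|/andP[_ fH]]; [left|right; exists H].
have nC K f : K \in C -> f \in edges K -> f.1 = inr n -> False.
  by move=> KC fK E; case/negP: nl; apply/labelsP; exists K, f.
split.
- move=> K /C'P[[R SR ->]|/DC /(si_wf I) //].
  by apply: wf_part => //; case: SR.
- by move=> K /C'P[[R SR ->]|/DC /(si_bi I) //]; apply: biconnected_part.
- move=> K L f g l KC LC fK gL fl gl.
  case: (eP _ _ KC fK) (eP _ _ LC gL) => [fE|[K' K'C fK']] [gE|[L' L'C gL']].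
  + by rewrite fE gE.
  + by case: (nC L' g) => //; rewrite gl -fl fE.
  + by case: (nC K' f) => //; rewrite fl -gl gE.
  + exact: (si_ends I K'C L'C fK' gL' fl gl).
- move=> l; have := si_label I l; rewrite (perm_sum_over _ P) (perm_sum_over _ P') /sum_over /=.
  rewrite addnA nlabel_parts addnAC; case: (eqVneq n l) => [E _|_]; last by rewrite addn0.
  rewrite nlabel0 ?add0n; last by move=> f fH fl; apply: (nC H f); rewrite // fl E.
  have -> // : sumn (map (nlabel l) D) = 0.
  apply: sum_over0 => K KD; apply: nlabel0 => f fK fl.
  by apply: (nC K f); rewrite ?fl ?E //; apply: DC.
- have := si_verts I; rewrite (perm_sum_over _ P) (perm_sum_over _ P') /sum_over /=.
  rewrite (perm_size P) (perm_size P') /= addnA size_verts_parts //; lia.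
- move=> _ K /C'P[[R SR ->]|KD]; first exact: size_edges_part.
  apply: (si_edges I); last exact: DC.
  by rewrite (perm_size P); case: (D) KD.
Qed.

Lemma split_inv_splits N C r C' : split_inv N C -> splits C r C' -> split_inv N C'.
Proof. by move=> I R; elim: R I => // {}C st C1 s C2 O _ IH /split_inv_step /(_ O). Qed.

Lemma split_inv_start G :
  wf_graph G -> all is_real (edges G) -> biconnected G -> split_inv (size (verts G)) [:: G].
Proof.
move=> W /allP A B.
have nr f l : f \in edges G -> f.1 = inr l -> False.
  by move=> /A; rewrite /is_real; case: f.1.
split=> //.
- by move=> H; rewrite inE => /eqP->.
- by move=> H; rewrite inE => /eqP->.
- by move=> H K f g l; rewrite !inE => /eqP-> /eqP-> fG _ /(nr _ _ fG).
- by move=> l; rewrite /sum_over /= addn0 nlabel0 // => f fG /(nr _ _ fG).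
- by rewrite /sum_over /= addn0.
Qed.

Lemma crun_splits C col r C' col' : crun C col r C' col' -> splits C r C'.
Proof. by elim=> *; econstructor; eauto. Qed.

(** * Ends of degree 2 and their persistence under splits *)

Definition deg2_end (K : graph) (f : edge) : Prop := exists2 x, incident f x & deg K x = 2.

Definition deg2_label (K : graph) (l : nat) : Prop :=
  exists f, [/\ f \in edges K, f.1 = inr l & deg2_end K f].

(* In a collection refining to the triconnected components this never happens: the two
   graphs would end up as cycle components sharing a virtual edge. *)
Definition twice_deg2 (C : seq graph) : Prop :=
  exists K L D l, [/\ perm_eq C (K :: L :: D), deg2_label K l & deg2_label L l].

(** Both sides have an edge at [a], so its two edges are divided one and one. Together with the new
    edge, [a] has degree 2 again in either part. *)
Lemma deg_parts_deg2 H u v Q a :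
  wf_graph H -> biconnected H -> sides H u v Q -> (a == u) || (a == v) -> deg H a = 2 ->
  count (fun f => Q f && incident f a) (edges H) = 1.
Proof.
move=> W B S auv; have [f [fH Qf jf]] : exists f, [/\ f \in edges H, Q f & incident f a].
  case/orP: auv => /eqP->; [exact: (side_touch W B S)|exact: (side_touch W B (sides_sym S))].
have [g [gH Qg ig]] : exists f, [/\ f \in edges H, predC Q f & incident f a].
  have SC := sidesC S.
  case/orP: auv => /eqP->; [exact: (side_touch W B SC)|exact: (side_touch W B (sides_sym SC))].
rewrite (deg_predC H Q).
have : 0 < count (fun f => Q f && incident f a) (edges H).
  by rewrite -has_count; apply/hasP; exists f; rewrite ?Qf.
have : 0 < count (fun f => predC Q f && incident f a) (edges H).
  by rewrite -has_count; apply/hasP; exists g; rewrite ?Qg.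
lia.
Qed.

Lemma deg2_label_part1 H u v n Q l f :
  wf_graph H -> biconnected H -> sides H u v Q ->
  f \in edges H -> f.1 = inr l -> deg2_end H f -> Q f -> deg2_label (part H u v n Q) l.
Proof.
move=> W B S fH fl [x jf dx] Qf; exists f; split=> //; first by rewrite edges_part Qf fH orbT.
exists x => //; case: (boolP ((x == u) || (x == v))) => [xuv|].
  by rewrite (deg_part_in _ _ _ xuv) (deg_parts_deg2 W B S xuv dx).
by rewrite negb_or => /andP[xu xv]; rewrite (deg_part_out n S xu xv fH Qf jf).
Qed.

Lemma deg2_label_parts H u v n Q l :
  wf_graph H -> biconnected H -> sides H u v Q -> deg2_label H l ->
  deg2_label (part H u v n Q) l \/ deg2_label (part H u v n (predC Q)) l.
Proof.
move=> W B S [f [fH fl df]]; case: (boolP (Q f)) => Qf; [left|right].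
  exact: deg2_label_part1 W B S fH fl df Qf.
exact: deg2_label_part1 W B (sidesC S) fH fl df Qf.
Qed.

Lemma twice_deg2_split C st C' :
  (forall H, H \in C -> wf_graph H) -> split_ok C st C' -> twice_deg2 C -> twice_deg2 C'.
Proof.
move=> Wf O [K [L [D' [l [PK dK dL]]]]]; have [D [P P']] := split_ok_perm O.
case: O => i B SW nl _; move: P P' B SW.
set H := nth _ _ _; set p1 := part _ _ _ _ _; set p2 := part _ _ _ _ _ => P P' B SW.
have HC : H \in C by rewrite (perm_mem P) inE eqxx.
have W := Wf _ HC; have S := sep_witness_sides (wf_loopless W) SW.
have ps := deg2_label_parts (l := l) (sl st) W B S.
move: (HC); rewrite (perm_mem PK) !inE => /or3P[/eqP E|/eqP E|HD].
- rewrite E in ps; case: (ps dK) => d; [exists p1, L, (p2 :: D'), l|exists p2, L, (p1 :: D'), l];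
  by rewrite /p1 /p2 E in P' * => //; split=> //; apply/permP=> a;
    move: (permP P a) (permP P' a) (permP PK a); rewrite E /=; lia.
- rewrite E in ps; case: (ps dL) => d; [exists K, p1, (p2 :: D'), l|exists K, p2, (p1 :: D'), l];
  by rewrite /p1 /p2 E in P' * => //; split=> //; apply/permP=> a;
    move: (permP P a) (permP P' a) (permP PK a); rewrite E /=; lia.
- exists K, L, (p1 :: p2 :: rem H D'), l; split=> //; apply/permP=> a.
  by move: (permP P a) (permP P' a) (permP PK a) (permP (perm_to_rem HD) a) => /=; lia.
Qed.

Lemma twice_deg2_splits N C r C' :
  split_inv N C -> splits C r C' -> twice_deg2 C -> twice_deg2 C'.
Proof.
move=> I R; elim: R I => // {}C st C1 s C2 O _ IH I T; apply: IH.
  exact: split_inv_step I O.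
exact: twice_deg2_split (si_wf I) O T.
Qed.

Definition ear_real (K : graph) (l : nat) : Prop :=
  exists f g, [/\ f.1 = inr l, earc K f g & is_real g].

Definition some_ear_real (C : seq graph) (l : nat) : Prop :=
  exists2 K, K \in C & ear_real K l.

(** Restricted to labels present in [C], so it holds vacuously at the start although nothing is
    coloured yet. *)
Definition coloured (C : seq graph) (col : nat -> option colour) : Prop :=
  forall l, l \in labels C ->
    (some_ear_real C l -> col l = Some Green) /\ (~ some_ear_real C l -> col l = Some Red).

Lemma earc_deg2_end K f g : earc K f g -> f = g \/ deg2_end K f.
Proof.
elim=> [_|h k x _ IH _ ih _ dx]; first by left.
by right; case: IH => // ->; exists x.
Qed.

(** * The colouring invariant *)

Lemma real_or_label (f : edge) : is_real f \/ exists l, f.1 = inr l.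
Proof. by rewrite /is_real; case: f.1 => [i|l]; [left|right; exists l]. Qed.

Lemma not_real_label (f : edge) l : f.1 = inr l -> ~ is_real f.
Proof. by rewrite /is_real => ->. Qed.

Lemma coloured_step C st C' col col' :
  (forall H, H \in C -> wf_graph H) -> split_ok C st C' -> ~ twice_deg2 C' ->
  coloured C col -> colour_step C st col col' -> coloured C' col'.
Proof.
move=> Wf O nT CC; have [D [P P']] := split_ok_perm O; rewrite /colour_step.
case: O => i B SW nl _; move: P P' B SW.
set H := nth _ _ _; set u := su st; set v := sv st; set n := sl st => P P' B SW.
have HC : H \in C by rewrite (perm_mem P) inE eqxx.
have DC K : K \in D -> K \in C by move=> KD; rewrite (perm_mem P) inE KD orbT.
have DC' K : K \in D -> K \in C' by move=> KD; rewrite (perm_mem P') !inE KD !orbT.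
have W := Wf _ HC; have S := sep_witness_sides (wf_loopless W) SW.
have nC K f : K \in C -> f \in edges K -> f.1 = inr n -> False.
  by move=> KC fK E; case/negP: nl; apply/labelsP; exists K, f.
have nH : n \notin labels_g H by apply/negP=> /labels_gP[f fH fn]; apply: (nC H f).
pose isQ Q := Q = sP st \/ Q = predC (sP st).
pose pQ Q := part H u v n Q.
pose en := vedge n u v.
have SQ Q : isQ Q -> sides H u v Q by case=> ->; [exact: S|exact: sidesC].
have WQ Q : isQ Q -> wf_graph (pQ Q) by move/SQ=> SS; apply: wf_part => //; case: SS.
have QC' Q : isQ Q -> pQ Q \in C' by case=> ->; rewrite (perm_mem P') !inE eqxx ?orbT.
have enQ Q : en \in edges (pQ Q) by apply: vedge_in_part.
have C'P K : K \in C' -> (exists2 Q, isQ Q & K = pQ Q) \/ K \in D.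
  by rewrite (perm_mem P') !inE => /or3P[/eqP->|/eqP->|];
    [left; exists (sP st) => //; left | left; exists (predC (sP st)) => //; right | right].
have CP K : K \in C -> K = H \/ K \in D.
  by rewrite (perm_mem P) inE => /orP[/eqP|]; auto.
have d2n Q a : (a == u) || (a == v) -> deg (pQ Q) a = 2 -> deg2_label (pQ Q) n.
  move=> auv da; exists en; split=> //; exists a => //.
  by rewrite /incident /= !(eq_sym _ a).
(* By [nT] the ear of the new edge can be longer than that edge in at most one of the parts. *)
have notboth Q Q' : isQ Q -> isQ Q' -> deg2_label (pQ Q) n -> deg2_label (pQ Q') n -> Q = Q'.
  by case=> -> [->|->] // d d'; case: nT; eexists _, _, D, n; split; eauto;
    apply: perm_trans P' _; apply/permP=> a /=; rewrite addnCA.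
have dH a : (a == u) || (a == v) -> deg H a <> 2.
  move=> auv da.
  have d Q : isQ Q -> deg2_label (pQ Q) n.
    move=> QQ; apply: (d2n Q a auv).
    by rewrite /pQ (deg_part_in _ _ _ auv) (deg_parts_deg2 W B (SQ Q QQ) auv da).
  (* A predicate would equal its own complement; evaluating at any edge, such as [en], refutes
     this. *)
  have E := notboth _ _ (or_introl erefl) (or_intror erefl)
    (d _ (or_introl erefl)) (d _ (or_intror erefl)).
  by have := congr1 (fun R : pred edge => R en) E; rewrite /=; case: (sP st en).
have du : deg H u <> 2 by apply: dH; rewrite eqxx.
have dv : deg H v <> 2 by apply: dH; rewrite eqxx orbT.
have loneP Q a c e : lone_edge H u v Q a c e ->
    [/\ (a == u) || (a == v), deg (pQ Q) a = 2 & earc (pQ Q) en e].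
  move=> [ac eH Qe ie C1].
  have auv : (a == u) || (a == v) by case: ac => -[-> _]; rewrite eqxx ?orbT.
  have da : deg (pQ Q) a = 2 by rewrite /pQ (deg_part_in _ _ _ auv) C1.
  split=> //; apply: earc_step (earc_refl (enQ Q)) _ _ ie da.
    by rewrite edges_part Qe eH orbT.
  by rewrite /incident /= !(eq_sym _ a).
have loneE Q a e g : (a == u) || (a == v) -> deg (pQ Q) a = 2 -> Q e -> incident e a ->
    earc H e g -> exists c, lone_edge H u v Q a c e.
  move=> auv; rewrite /pQ (deg_part_in _ _ _ auv) => -[C1] Qe ie eg.
  have eH := earc_edgel eg.
  by case/orP: auv => /eqP E; [exists v|exists u]; split=> //; auto.
have TFP c e := twofiveP c e W B S.
have onP Q l : isQ Q -> on_ear (pQ Q) en l <-> exists2 f, earc (pQ Q) en f & f.1 = inr l.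
  by move/WQ=> WW; apply: on_earP.
have labC' l : l \in labels C' -> l = n \/ l \in labels C.
  case/labelsP=> K [f [/C'P[[Q _ ->]|KD] fK fl]]; last first.
    by right; apply/labelsP; exists K, f; split=> //; apply: DC.
  move: fK; rewrite edges_part => /orP[/eqP E|/andP[_ fH]].
    by left; move: fl; rewrite E => -[].
  by right; apply/labelsP; exists H, f.
(* An old label can change its status only by sharing the ear of the new edge with a real edge: any
   other chain in a part is already a chain of [H]. *)
have old l : l != n ->
    (forall Q f g, isQ Q -> earc (pQ Q) en f -> f.1 = inr l -> is_real g -> ~ earc (pQ Q) en g) ->
    some_ear_real C' l <-> some_ear_real C l.
  move=> ln A; split=> [[K KC' [f [g [fl fg rg]]]]|[K KC [f [g [fl fg rg]]]]].
    case: (C'P _ KC') => [[Q QQ E]|KD]; last by exists K; [apply: DC|exists f, g].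
    subst K; move: (earc_edgel fg); rewrite edges_part => /orP[/eqP E|/andP[Qf fH]].
      by move: fl ln; rewrite E => -[->]; rewrite eqxx.
    case: (earc_part_old (SQ _ QQ) du dv fg fH Qf) => [fg'|enf].
      by exists H => //; exists f, g.
    by case: (A Q f g) => //; apply: earc_trans enf fg.
  case: (CP _ KC) => [E|KD]; last by exists K; [apply: DC'|exists f, g].
  subst K; have [Q QQ Qf] : exists2 Q, isQ Q & Q f.
    by case: (boolP (sP st f)) => Qf; [exists (sP st)|exists (predC (sP st))]; rewrite /isQ; auto.
  have [_ fg'] := earc_part n (SQ _ QQ) du dv fg Qf.
  by exists (pQ Q); [apply: QC'|exists f, g].
have CCx l : l \in labels C -> col l = Some Green -> some_ear_real C l.
  by move=> /CC [_ r] g; apply: NNPP => /r; rewrite g.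
have eC e m : e \in edges H -> e.1 = inr m -> m \in labels C.
  by move=> eH em; apply/labelsP; exists H, e.
case=> c1 c2 c3 c4.
case: (classic (exists c e, twofive H st c e /\
              (is_real e \/ exists m, e.1 = inr m /\ col m = Some Green))) => [G2|nG2].
  have {}c2 := c2 G2; case: G2 => c [e [/TFP [Q [a [QQ lo]]] eg]].
  have [auv da ene] := loneP _ _ _ _ lo; have [_ eH Qe ie _] := lo.
  (* If [e] is green, a real edge shares an ear with its label in some graph. In [H] that ear passes
     to the part and joins the ear of the new edge. In another graph [K] it would give the label an
     end of degree 2 there, besides the end [a] of [e] in the part, against [nT]. *)
  have [g rg eng] : exists2 g, is_real g & earc (pQ Q) en g.
    case: eg => [re|[m [em gm]]]; first by exists e.
    have [K KC [f [g [fm fg rg]]]] := CCx _ (eC _ _ eH em) gm.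
    case: (CP _ KC) => [E|KD].
      subst K; have E : f = e by apply: (wf_kind_inj W) => //; [exact: earc_edgel fg|rewrite fm].
      subst f; have [_ eg] := earc_part n (SQ _ QQ) du dv fg Qe.
      by exists g => //; apply: earc_trans ene eg.
    case: nT; have dK : deg2_label K m.
      exists f; split=> //; first exact: earc_edgel fg.
      by case: (earc_deg2_end fg) => // E; case: (not_real_label fm); rewrite E.
    have dQ : deg2_label (pQ Q) m.
      by exists e; split=> //; [exact: earc_edger ene|exists a].
    have [Q' PQ] : exists Q', perm_eq C' (pQ Q :: pQ Q' :: D).
      case: QQ => ->; first by exists (predC (sP st)).
      by exists (sP st); apply: perm_trans P' _; apply/permP=> b /=; rewrite addnCA.
    exists (pQ Q), K, (pQ Q' :: rem K D), m; split=> //; apply: perm_trans PQ _.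
    by apply/permP=> b /=; move: (permP (perm_to_rem KD) b) => /= ->; congr addn; rewrite addnCA.
  move=> l lC'; case: (c2 l) => yes no.
  case: (classic (on_ear (pQ (sP st)) en l \/ on_ear (pQ (predC (sP st))) en l)) => [on|off].
    split=> [_|N]; [exact: yes|case: N].
    have [Q' [f [QQ' enf fl]]] : exists Q' f, [/\ isQ Q', earc (pQ Q') en f & f.1 = inr l].
      have [Q' QQ' on'] : exists2 Q', isQ Q' & on_ear (pQ Q') en l.
        by case: on => on; [exists (sP st)|exists (predC (sP st))] => //; [left|right].
      by have /onP [//|f enf fl] := on'; exists Q', f.
    exists (pQ Q); first exact: QC'.
    (* Either the label is the new one, or the ear extends beyond the new edge and then lies in the
       same part as [g]. *)
    case: (earc_part_new (SQ _ QQ') enf) => [E|[a' [e' [auv' da' _ _ _]]]].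
      by exists en, g; split=> //; rewrite -fl E.
    have E := notboth _ _ QQ' QQ (d2n _ _ auv' da') (d2n _ _ auv da); subst Q'.
    by exists f, g; split=> //; apply: earc_trans (earc_sym enf) eng.
  rewrite (no off).
  have A Q' f : isQ Q' -> earc (pQ Q') en f -> f.1 = inr l -> False.
    move=> QQ' enf fl; apply: off.
    by case: (QQ') => <-; [left|right]; apply/onP=> //; exists f.
  have ln : l != n.
    by apply/eqP=> E; apply: (A Q en QQ); [apply: earc_refl|rewrite E].
  have o : some_ear_real C' l <-> some_ear_real C l.
    by apply: old => // Q' f h QQ' enf fl; case: (A Q' f).
  by rewrite o; apply: CC; case: (labC' _ lC') => // E; rewrite E eqxx in ln.
(* A real edge on the ear of the new edge would share an ear of [H] with the lone edge [e] at an end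
   of the new edge; then [e] is real or already green, and the green rule would apply. *)
have noNR Q g : isQ Q -> earc (pQ Q) en g -> ~ is_real g.
  move=> QQ /(earc_part_new (SQ _ QQ)) [-> //|[a [e [auv da Qe ie eg]]]] rg.
  have [c lo] := loneE _ _ _ _ auv da Qe ie eg.
  apply: nG2; exists c, e; split; first by apply/TFP; exists Q, a.
  case: (real_or_label e) => [|[m em]]; [by left|right; exists m; split=> //].
  have [-> //] := CC _ (eC _ _ (earc_edgel eg) em).
  by exists H => //; exists e, g.
(* If the split is a 2.5-split outside the green rule, every possible [e] is virtual and not green,
   hence red because each label present has a colour. *)
have colE : col' = upd col n Red.
  case: (classic (exists c e, twofive H st c e)) => [TF|/c1 //].
  apply: c3; split=> // c e tf.
  have eH : e \in edges H by case: tf => [[[]]].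
  case: (real_or_label e) => [re|[m em]].
    by case: nG2; exists c, e; split=> //; left.
  exists m; split=> //; case: (CC _ (eC _ _ eH em)) => gr rd.
  case: (classic (some_ear_real C m)) => [/gr gm|/rd //].
  by case: nG2; exists c, e; split=> //; right; exists m.
move=> l lC'; rewrite colE /upd; case: (eqVneq l n) => [->|ln].
  split=> // -[K KC' [f [g [fl fg rg]]]].
  have fK := earc_edgel fg.
  case: (C'P _ KC') => [[Q QQ E]|KD]; last by case: (nC K f) => //; apply: DC.
  subst K; have E : f = en by apply: (wf_kind_inj (WQ _ QQ)).
  by subst f; case: (noNR Q g).
have o : some_ear_real C' l <-> some_ear_real C l.
  by apply: old => // Q f g QQ _ _ rg eng; apply: (noNR Q g).
by rewrite o; apply: CC; case: (labC' _ lC') => // E; rewrite E eqxx in ln.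
Qed.

Lemma coloured_crun N C col r C' col' :
  crun C col r C' col' -> split_inv N C -> ~ twice_deg2 C' -> coloured C col -> coloured C' col'.
Proof.
elim=> // {}C {}col st C1 col1 s C2 col2 O c R IH I nT CC.
have I1 := split_inv_step I O; apply: IH => //.
apply: coloured_step (si_wf I) O _ CC c.
by move=> T; apply: nT; apply: twice_deg2_splits I1 (crun_splits R) T.
Qed.

(** * Merges and triconnected components *)

(** Lets a single vertex of degree 2 reveal a cycle among connected graphs with at least three
    edges. *)
Definition deg2_all_or_none (H : graph) : Prop :=
  (forall x, x \in verts H -> deg H x = 2) \/ (forall x, x \in verts H -> deg H x <> 2).

Lemma joins_incidentE f x y z : joins f x y -> incident f z = (z == x) || (z == y).
Proof.
move=> J; apply/idP/orP => [/(joins_end J)[]->|[]/eqP->]; rewrite ?eqxx; auto.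
  exact: joins_incidentl J.
exact: joins_incidentr J.
Qed.

Lemma deg2_two_edges H a : wf_graph H -> deg H a = 2 ->
  exists e f, [/\ e != f, e \in edges H, f \in edges H, incident e a & incident f a].
Proof.
move=> /wf_uniq_edges /(filter_uniq (fun f => incident f a)) U.
rewrite /deg -size_filter; case E: (filter _ _) U => [|e [|f [|? ?]]] // U _.
have : e \in filter (fun f => incident f a) (edges H) by rewrite E inE eqxx.
have : f \in filter (fun f => incident f a) (edges H) by rewrite E !inE eqxx orbT.
rewrite !mem_filter => /andP[jf fH] /andP[ie eH]; exists e, f; split=> //.
by move: U; rewrite /= inE andbT.
Qed.

Section Unsplittable.
Variables (H : graph) (a b c : nat) (e f : edge).
Hypotheses (wfH : wf_graph H) (biH : biconnected H) (sz : 2 < size (edges H)).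
Hypotheses (da : deg H a = 2) (ef : e != f) (eH : e \in edges H) (fH : f \in edges H).
Hypotheses (Jb : joins e a b) (Jc : joins f a c).
Let LH := wf_loopless wfH.

Let at_a g : g \in edges H -> incident g a = (g == e) || (g == f).
Proof.
move=> gH; have ie := joins_incidentl Jb; have jf := joins_incidentl Jc.
apply/idP/orP => [ig|[]/eqP-> //].
by case: (deg2_edges da ef eH fH gH ie jf ig) => ->; auto.
Qed.

(** If both edges at [a] led to [b], an edge off [a] would have an end that [b] separates from [a].
    So all edges would be at [a], and there would be only two. *)
Lemma deg2_ends_neq : b <> c.
Proof.
move=> bc; have ab := joins_neq LH eH Jb.
suff A : all (fun g => incident g a) (edges H).
  by move: sz; rewrite -(eqP (etrans (esym (all_count _ _)) A)) -/(deg H a) da.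
apply/allP=> g gH; apply/negPn/negP=> nga.
have [w iw wb] := end_neq b LH gH.
have wa : w != a by apply: contraNneq nga => <-.
have [_ /(_ w a b (incident_vert LH gH iw))] := biH.
move=> /(_ (incident_vert LH eH (joins_incidentl Jb))
  (incident_vert LH eH (joins_incidentr Jb)) wa wb ab) R.
suff : a != a by rewrite eqxx.
elim: {-2}a / R => [//|y h z R ya hH _ J zb]; apply/eqP=> za; subst z.
have Jh : joins h a b.
  move: (joins_incidentr J); rewrite (at_a hH) => /orP[]/eqP-> //.
  by rewrite bc.
case: (joins_end Jh (joins_incidentl J)) => E; first by rewrite E eqxx in ya.
by have := reach_ok R; rewrite E eqxx.
Qed.

Hypothesis nsep : ~ separation_pair H b c.
Let P : pred edge := pred2 e f.

Let countP : count P (edges H) = 2.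
Proof. by rewrite -da; apply: eq_in_count => g gH; rewrite /= at_a. Qed.

(** The ends of [e] and [f] are [a], [b] and [c], and all edges at [a] are in [P]. A path without
    [b] and [c] inside therefore never passes between [P] and the other edges. *)
Let sepP : 1 < count (predC P) (edges H) -> sep_witness H b c P.
Proof.
have bH := incident_vert LH eH (joins_incidentr Jb).
have cH := incident_vert LH fH (joins_incidentr Jc).
move=> cC; split; rewrite ?countP //; first by split=> //; apply/eqP/deg2_ends_neq.
move=> e1 f1 e1H f1H [x0 [p [[W _] e1p f1p bi ci]]].
have sp x g h : x \in internal x0 p -> g \in edges H -> h \in edges H ->
    incident g x -> incident h x -> P g -> P h.
  move=> xi gH hH ig ih Pg; rewrite /P /= -at_a //.
  have xb : x <> b by move=> E; rewrite E (negbTE bi) in xi.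
  have xc : x <> c by move=> E; rewrite E (negbTE ci) in xi.
  suff <- : x = a by [].
  case/orP: Pg => /eqP E; subst g; [case: (joins_end Jb ig)|case: (joins_end Jc ig)] => //.
apply/idP/idP; exact: (walk_spread (R := fun g => P g) W sp).
Qed.

(** By [sepP] exactly one edge remains besides [e] and [f]. A path from [b] to [c] avoiding [a] can
    only use that edge, so it joins [b] and [c] and [H] is a triangle. *)
Lemma unsplittable_deg2 x : x \in verts H -> deg H x = 2.
Proof.
have szC : count (predC P) (edges H) = 1.
  have := count_predC P (edges H); rewrite countP.
  have : ~ 1 < count (predC P) (edges H) by move=> /sepP S; apply: nsep; exists P.
  lia.
have bc : b != c by apply/eqP/deg2_ends_neq.
have ab := joins_neq LH eH Jb; have ac := joins_neq LH fH Jc.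
have aH := incident_vert LH eH (joins_incidentl Jb).
have bH := incident_vert LH eH (joins_incidentr Jb).
have cH := incident_vert LH fH (joins_incidentr Jc).
have [_ /(_ b c a bH cH aH bc)] := biH; rewrite ![_ == a]eq_sym => /(_ ab ac) R.
have [E|[g [gH nP ib ic]]] : c = b \/
    exists g, [/\ g \in edges H, predC P g, incident g b & incident g c].
- elim: R => [|y h z R IH hH _ J za]; first by left.
  right; have nh : predC P h.
    rewrite /P /= -at_a //; apply/negP=> ia; case: (joins_end J ia) => E.
      by have := reach_ok R; rewrite E eqxx.
    by rewrite E eqxx in za.
  case: IH => [E|[g [gH nP ib _]]].
    by exists h; split=> //; [rewrite -E (joins_incidentl J)|exact: joins_incidentr J].
  have E := count1_eq szC gH nP hH nh; subst g.
  by exists h; split=> //; exact: joins_incidentr J.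
- by rewrite E eqxx in bc.
have Jg : joins g b c.
  have [y J] := incident_joins ib; case: (joins_end J ic) => E; last by rewrite E.
  by rewrite E eqxx in bc.
have eE h : (h \in edges H) = (h \in [:: e; f; g]).
  rewrite !inE; apply/idP/or3P => [hH|[]/eqP-> //].
  case: (boolP (P h)) => [/orP[]/eqP->|nh]; [constructor 1|constructor 2|constructor 3] => //.
  by rewrite (count1_eq szC gH nP hH nh).
have pE : perm_eq (edges H) [:: e; f; g].
  apply: uniq_perm => //; first exact: wf_uniq_edges wfH.
  move: nP; rewrite /P /= !inE !negb_or ef => /andP[ge gf].
  by rewrite eq_sym ge eq_sym gf.
have dE y : deg H y = ((y == a) || (y == b)) + (((y == a) || (y == c)) + ((y == b) || (y == c))).
  rewrite /deg (permP pE) /= !(joins_incidentE _ Jb) !(joins_incidentE _ Jc).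
  by rewrite (joins_incidentE _ Jg) addn0.
move=> xH; have : [|| x == a, x == b | x == c].
  case: (eqVneq x a) => //= xa.
  have ax : a != x by rewrite eq_sym.
  have [h] := reach_edge_incident (biH.1 a x aH xH) ax.
  rewrite eE !inE => /or3P[]/eqP->; rewrite ?(joins_incidentE _ Jb) ?(joins_incidentE _ Jc)
    ?(joins_incidentE _ Jg) ?(negbTE xa) //= => -> //.
  by rewrite orbT.
rewrite dE => /or3P[]/eqP->; rewrite !eqxx ?(negbTE ab) ?(negbTE ac) ?(negbTE bc) //=.
  by rewrite eq_sym (negbTE ab).
by rewrite !(eq_sym c) (negbTE ac) (negbTE bc).
Qed.

End Unsplittable.

Lemma unsplittable_deg2_all_or_none H :
  wf_graph H -> biconnected H -> 2 < size (edges H) -> ~ can_split H -> deg2_all_or_none H.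
Proof.
move=> W B sz nc; case: (classic (exists a, deg H a = 2)) => [[a da]|N]; last first.
  by right=> x _ dx; apply: N; exists x.
left=> x; have [e [f [ef eH fH ie jf]]] := deg2_two_edges W da.
have [b Jb] := incident_joins ie; have [c Jc] := incident_joins jf.
apply: (unsplittable_deg2 W B sz da ef eH fH Jb Jc) => S.
by apply: nc; split=> //; exists b, c.
Qed.

Lemma merge_ok_perm C i j l C' :
  merge_ok C i j l C' ->
  let H1 := nth g0 C i in let H2 := nth g0 C j in
  exists D, perm_eq C (H1 :: H2 :: D) /\
    C' = (undup (verts H1 ++ verts H2),
          filter (fun f : edge => f.1 != inr l) (edges H1 ++ edges H2)) :: D.
Proof.
move=> [ij jC _ ->] H1 H2; eexists; split; last reflexivity.
have zE : zip (iota 0 (size C)) C = [seq (k, nth g0 C k) | k <- iota 0 (size C)].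
  rewrite -{2}(mkseq_nth g0 C) /mkseq.
  by elim: (iota 0 (size C)) => //= k s ->.
have iE : perm_eq (iota 0 (size C)) (i :: j :: [seq k <- iota 0 (size C) | (k != i) && (k != j)]).
  apply: uniq_perm; rewrite ?iota_uniq //=.
    by rewrite !inE !mem_filter !eqxx /= andbF filter_uniq ?iota_uniq // orbF andbT (ltn_eqF ij).
  move=> k; rewrite !inE mem_filter mem_iota /=.
  case: (eqVneq k i) => [->|] /=; first by rewrite add0n (ltn_trans ij).
  by case: (eqVneq k j) => [->|] /=.
rewrite zE filter_map -map_comp -{1}(mkseq_nth g0 C) /mkseq.
exact: (perm_map (nth g0 C) iE).
Qed.

Record merge_inv (C : seq graph) : Prop := MergeInv {
  mi_loopless : forall H, H \in C -> loopless H;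
  mi_ends : forall H K f g l, H \in C -> K \in C -> f \in edges H -> g \in edges K ->
    f.1 = inr l -> g.1 = inr l -> f.2 = g.2;
  mi_label : forall l, sum_over (nlabel l) C <= 2 }.

Lemma split_merge_inv N C : split_inv N C -> merge_inv C.
Proof.
move=> I; split; [|exact: si_ends I|exact: si_label I].
by move=> H /(si_wf I) /wf_loopless.
Qed.

Lemma size_undup_cat (s t : seq nat) : uniq s -> uniq t ->
  size (undup (s ++ t)) + count (mem t) s = size s + size t.
Proof.
move=> us ut; rewrite undup_cat size_cat !undup_id // size_filter.
rewrite -(count_predC (mem t) s) addnAC; congr addn.
by rewrite addnC; congr addn; apply: eq_count.
Qed.

Lemma count_lone_label E l (f : edge) x :
  count (fun h : edge => h.1 == inr l) E = 1 -> f \in E -> f.1 = inr l ->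
  count (fun h : edge => incident h x && (h.1 == inr l)) E = incident f x.
Proof.
move=> c1 fE fl; case: (boolP (incident f x)) => i.
  apply: etrans (c1); apply: eq_in_count => h hE; case: eqP => hl; rewrite ?andbF ?andbT //.
  by rewrite -(count1_eq c1 fE _ hE) ?fl ?hl.
apply/eqP; rewrite -leqn0 leqNgt -has_count; apply/negP=> /hasP[h hE /andP[ih hl]].
by case/negP: i; rewrite (count1_eq c1 fE _ hE hl) ?fl.
Qed.

Lemma count_other_label E l x :
  count (fun h : edge => incident h x) E =
  count (fun h : edge => incident h x) (filter (fun h : edge => h.1 != inr l) E) +
  count (fun h : edge => incident h x && (h.1 == inr l)) E.
Proof.
elim: E => //= h E ->; case: (h.1 == inr l); rewrite ?andbT ?andbF /=.
  by rewrite addnCA.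
by rewrite add0n addnA.
Qed.

Section Merge.
Variables (H1 H2 : graph) (D : seq graph) (l u v : nat) (g : edge).
Let M : graph := (undup (verts H1 ++ verts H2),
  filter (fun f : edge => f.1 != inr l) (edges H1 ++ edges H2)).
Let f : edge := vedge l u v.
Hypotheses (I : merge_inv (H1 :: H2 :: D)) (fH : f \in edges H1).
Hypotheses (gH : g \in edges H2) (gl : g.1 = inr l).

Let H1C : H1 \in H1 :: H2 :: D. Proof. by rewrite inE eqxx. Qed.
Let H2C : H2 \in H1 :: H2 :: D. Proof. by rewrite !inE eqxx orbT. Qed.
Let L1 := mi_loopless I H1C.
Let L2 := mi_loopless I H2C.

Let vM x : (x \in verts M) = (x \in verts H1) || (x \in verts H2).
Proof. by rewrite /M /verts mem_undup mem_cat. Qed.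

Let eM h : h \in edges M -> h \in edges H1 \/ h \in edges H2.
Proof. by rewrite /M /edges mem_filter mem_cat => /andP[_ /orP[]]; auto. Qed.

Lemma merge_loopless : loopless M.
Proof.
split; first exact: undup_uniq.
move=> h /eM[] hH; rewrite !vM; [have [_ A] := L1|have [_ A] := L2];
  by have [-> -> ->] := A _ hH; rewrite ?orbT.
Qed.

Lemma merge_inv_merge : merge_inv (M :: D).
Proof.
have src K h : K \in M :: D -> h \in edges K ->
    exists2 K', K' \in H1 :: H2 :: D & h \in edges K'.
  rewrite inE => /orP[/eqP->|KD hK]; last by exists K => //; rewrite !inE KD !orbT.
  by case/eM=> hH; [exists H1|exists H2].
split.
- move=> K; rewrite inE => /orP[/eqP->|KD]; first exact: merge_loopless.
  by apply: (mi_loopless I); rewrite !inE KD !orbT.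
- move=> K K' h h' k KC KC' hK hK' hk hk'.
  have [L LC hL] := src _ _ KC hK; have [L' LC' hL'] := src _ _ KC' hK'.
  exact: (mi_ends I LC LC' hL hL' hk hk').
- move=> k; apply: leq_trans (mi_label I k); rewrite /sum_over /= addnA leq_add2r.
  rewrite /nlabel -count_cat /M /edges /= count_filter; apply: sub_count => h.
  by case/andP.
Qed.

Let gE : g.2 = (u, v).
Proof. exact: (mi_ends I H2C H1C gH fH gl). Qed.

Let lone12 : nlabel l H1 = 1 /\ nlabel l H2 = 1.
Proof.
have := mi_label I l; rewrite /sum_over /=.
have : 0 < nlabel l H1 by rewrite -has_count; apply/hasP; exists f; rewrite //= eqxx.
have : 0 < nlabel l H2 by rewrite -has_count; apply/hasP; exists g; rewrite //= gl eqxx.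
lia.
Qed.

Let uv : u != v.
Proof. by have [_ /(_ _ fH) []] := L1. Qed.

Let uv1 : (u \in verts H1) && (v \in verts H1).
Proof. by have [_ /(_ _ fH) [-> -> _]] := L1. Qed.

Let uv2 : (u \in verts H2) && (v \in verts H2).
Proof. by have [_ /(_ _ gH)] := L2; rewrite /eu /ev gE => -[-> -> _]. Qed.

Let sub2 : {subset [:: u; v] <= filter (mem (verts H2)) (verts H1)}.
Proof.
move=> x; rewrite !inE mem_filter; case/andP: uv1 => u1 v1; case/andP: uv2 => u2 v2.
by case/orP=> /eqP->; apply/andP.
Qed.

Let sizes : size (verts M) + count (mem (verts H2)) (verts H1) =
  size (verts H1) + size (verts H2).
Proof. by apply: size_undup_cat; [case: L1|case: L2]. Qed.

(** Both graphs contain [u] and [v]; further common vertices would be identified as well, hence only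
    an inequality. *)
Lemma merge_size : size (verts M) + 2 <= size (verts H1) + size (verts H2).
Proof.
rewrite -sizes leq_add2l -size_filter.
by apply: (uniq_leq_size (s1 := [:: u; v])) sub2; rewrite /= inE uv.
Qed.

Lemma deg_merge x : deg M x + (incident f x).*2 = deg H1 x + deg H2 x.
Proof.
case: lone12 => n1 n2.
have ig : incident g x = incident f x by rewrite /incident /eu /ev gE.
have := count_other_label (edges H1) l x; rewrite (count_lone_label x n1 fH erefl).
have := count_other_label (edges H2) l x; rewrite (count_lone_label x n2 gH gl) ig.
rewrite /deg => -> ->; rewrite /M /edges /= filter_cat count_cat -addnn.
by rewrite addnACA.
Qed.

Hypothesis tight : size (verts M) + 2 = size (verts H1) + size (verts H2).

Lemma tight_common x : x \in verts H1 -> x \in verts H2 -> (x == u) || (x == v).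
Proof.
move=> x1 x2; have c2 : count (mem (verts H2)) (verts H1) = 2.
  by apply: (@addnI (size (verts M))); rewrite sizes tight.
have U2 : uniq [:: u; v] by rewrite /= inE uv.
have [|_ /(_ x)] := uniq_min_size U2 sub2; first by rewrite size_filter c2.
by rewrite mem_filter /= x1 x2 !inE => ->.
Qed.

(** At [u] and [v] the degree is 2 + 2 - 2. By [tight] every other vertex lies in one cycle only; a
    further common vertex would get degree 4. *)
Lemma merge_cycles :
  (forall x, x \in verts H1 -> deg H1 x = 2) -> (forall x, x \in verts H2 -> deg H2 x = 2) ->
  forall x, x \in verts M -> deg M x = 2.
Proof.
move=> d1 d2 x; rewrite vM => xM; have := deg_merge x.
have -> : incident f x = (x == u) || (x == v) by rewrite /incident /= !(eq_sym _ x).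
case: (boolP ((x == u) || (x == v))) => [xuv|nx].
  have -> : deg H1 x = 2 by apply: d1; case/andP: uv1 => u1 v1; case/orP: xuv => /eqP->.
  have -> : deg H2 x = 2 by apply: d2; case/andP: uv2 => u1 v1; case/orP: xuv => /eqP->.
  by lia.
case: (boolP (x \in verts H1)) xM => [x1 _|x1 /= x2].
  case: (boolP (x \in verts H2)) => x2; first by rewrite (tight_common x1 x2) in nx.
  by rewrite (d1 _ x1) (deg0_notin L2 x2) !addn0.
by rewrite (d2 _ x2) (deg0_notin L1 x1) addn0.
Qed.

(** Every edge of the merged graph joins [u] and [v], so both degrees equal the number of edges. *)
Lemma merge_bonds :
  size (verts H1) = 2 -> size (verts H2) = 2 -> deg2_all_or_none M.
Proof.
move=> s1 s2.
have U2 : uniq [:: u; v] by rewrite /= inE uv.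
have K H : size (verts H) = 2 -> (u \in verts H) && (v \in verts H) -> verts H =i [:: u; v].
  move=> sH /andP[uH vH] x; have [||_ /(_ x) -> //] := uniq_min_size U2 (s2 := verts H).
    by move=> y; rewrite !inE => /orP[]/eqP->.
  by rewrite sH.
have VM x : (x \in verts M) = (x == u) || (x == v).
  by rewrite vM (K _ s1 uv1) (K _ s2 uv2) orbb !inE.
have dE x : x \in verts M -> deg M x = size (edges M).
  rewrite VM => xuv; apply/eqP; rewrite -all_count; apply/allP=> h hM.
  have [_ /(_ _ hM)] := merge_loopless; rewrite !VM /incident => -[].
  by case/orP: xuv => /eqP-> /orP[]/eqP-> /orP[]/eqP->; rewrite ?eqxx ?orbT.
case: (eqVneq (size (edges M)) 2) => E; [left|right] => x /dE ->; first exact: E.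
exact/eqP.
Qed.

End Merge.

Lemma typed_merge_step C i j l C' :
  typed_merge C i j l C' -> merge_inv C ->
  [/\ merge_inv C', size C = (size C').+1,
      sum_over (size \o verts) C' + 2 <= sum_over (size \o verts) C &
      sum_over (size \o verts) C' + 2 = sum_over (size \o verts) C ->
      (forall H, H \in C -> deg2_all_or_none H) -> forall H, H \in C' -> deg2_all_or_none H].
Proof.
move=> [O ty] I; have [D [P ->]] := merge_ok_perm O.
case: O => _ _ [u [v [fH gH]]] _; move: ty P fH gH.
set H1 := nth g0 C i; set H2 := nth g0 C j => ty P fH gH.
have {gH} [g gH gl] : exists2 g, g \in edges H2 & g.1 = inr l.
  by case: gH => gH; eexists; try exact: gH.
have {}I : merge_inv (H1 :: H2 :: D).
  split=> [H|H K f h k|k]; rewrite -?(perm_mem P) -?(perm_sum_over _ P).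
  - exact: mi_loopless I H.
  - exact: mi_ends I H K f h k.
  - exact: mi_label I k.
have sM := merge_size I fH gH gl.
split.
- exact: merge_inv_merge I.
- by rewrite (perm_size P).
- by rewrite (perm_sum_over _ P) /sum_over /= addnA addnAC leq_add2r.
rewrite (perm_sum_over _ P) /sum_over /= addnAC addnA => /addIn tight dC H.
rewrite inE => /orP[/eqP->|HD]; last by apply: dC; rewrite (perm_mem P) !inE HD !orbT.
case: ty => [[[_ [_ d1]] [_ [_ d2]]]|[[s1 _] [s2 _]]].
  by left; apply: (merge_cycles I fH gH gl tight d1 d2).
exact: (merge_bonds I fH gH gl s1 s2).
Qed.

Lemma tmerges_inv C C' : tmerges C C' -> merge_inv C ->
  [/\ merge_inv C', size C' <= size C &
      sum_over (size \o verts) C' + (size C).*2 <= sum_over (size \o verts) C + (size C').*2].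
Proof.
elim=> [//|{}C i j l C1 C2 T _ IH I].
have [I1 s1 t1 _] := typed_merge_step T I; have [I2 s2 t2] := IH I1.
by split=> //; [rewrite s1; lia|lia].
Qed.

(** No merge raises the vertex sum minus twice the number of graphs, so equality between first and
    last collection forces equality at every merge. *)
Lemma tmerges_deg2_all_or_none C C' : tmerges C C' -> merge_inv C ->
  sum_over (size \o verts) C' + (size C).*2 = sum_over (size \o verts) C + (size C').*2 ->
  (forall H, H \in C -> deg2_all_or_none H) -> forall H, H \in C' -> deg2_all_or_none H.
Proof.
elim=> [//|{}C i j l C1 C2 T R IH I E dC].
have [I1 s1 t1 d1] := typed_merge_step T I; have [_ s2 t2] := tmerges_inv R I1.
apply: IH => //; first by lia.
by apply: d1 => //; lia.
Qed.

(** * Isomorphic collections *)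

Lemma bounded_inj_surj (pi : nat -> nat) n :
  (forall i, i < n -> pi i < n) ->
  (forall i j, i < n -> j < n -> pi i = pi j -> i = j) ->
  perm_eq (map pi (iota 0 n)) (iota 0 n).
Proof.
move=> b inj.
have U : uniq (map pi (iota 0 n)).
  rewrite map_inj_in_uniq ?iota_uniq // => i j; rewrite !mem_iota /= => ? ?; exact: inj.
have sub : {subset map pi (iota 0 n) <= iota 0 n}.
  by move=> x /mapP[i]; rewrite !mem_iota /= !add0n => /b ? ->.
have [|_ E] := uniq_min_size U sub; first by rewrite size_map.
by apply: uniq_perm => //; apply: iota_uniq.
Qed.

Lemma bounded_inj_onto (pi : nat -> nat) n :
  (forall i, i < n -> pi i < n) ->
  (forall i j, i < n -> j < n -> pi i = pi j -> i = j) ->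
  forall j, j < n -> exists2 i, i < n & pi i = j.
Proof.
move=> b inj j jn; have /perm_mem /(_ j) := bounded_inj_surj b inj.
rewrite mem_iota /= add0n jn => /mapP[i]; rewrite mem_iota /= add0n => ? ->.
by exists i.
Qed.

Lemma coll_iso_sum_over s C C' : coll_iso s C C' ->
  (forall H, H \in C -> uniq (verts H)) -> (forall H, H \in C' -> uniq (verts H)) ->
  sum_over (size \o verts) C = sum_over (size \o verts) C'.
Proof.
move=> [_ [sz [pi [b inj iso]]]] U U'; rewrite /sum_over.
rewrite -{1}(mkseq_nth g0 C) -{1}(mkseq_nth g0 C') /mkseq -!map_comp -sz.
rewrite -sz in b; have p := bounded_inj_surj b inj.
rewrite -[RHS](perm_sumn (perm_map _ p)) -map_comp; congr sumn.
apply/eq_in_map=> i; rewrite mem_iota /= add0n => iC.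
have [vE _] := iso _ iC; apply: perm_size; apply: uniq_perm => //.
  by apply: U; apply: mem_nth.
by apply: U'; apply: mem_nth; rewrite -sz b.
Qed.

Lemma incident_nrm f x : incident (nrm f) x = incident f x.
Proof. by rewrite /incident /nrm /eu /ev /=; case: (leqP f.2.1 f.2.2); rewrite // orbC. Qed.

Lemma joins_nrm f x y : joins (nrm f) x y = joins f x y.
Proof.
rewrite /joins /nrm /eu /ev /=; case: (leqP f.2.1 f.2.2) => // _.
by rewrite orbC andbC [X in _ || X]andbC.
Qed.

Section SameGraph.
Variables (s : nat -> nat) (K K' : graph).
Hypothesis same : same_graph (rename_g s K) K'.

Lemma same_deg x : deg K x = deg K' x.
Proof.
case: same => _ /permP /(_ (fun f => incident f x)); rewrite !count_map /deg => E.
transitivity (count (preim (rename s) (preim nrm (fun f => incident f x))) (edges K)).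
  by apply: eq_count => f /=; rewrite incident_nrm.
by rewrite E; apply: eq_count => f /=; rewrite incident_nrm.
Qed.

Lemma same_edge f : f \in edges K -> exists2 f', f' \in edges K' & nrm f' = nrm (rename s f).
Proof.
case: same => _ /perm_mem E fK.
have : nrm (rename s f) \in map nrm (edges K') by rewrite -E; do 2!apply: map_f.
by case/mapP=> f' fK' ->; exists f'.
Qed.

Lemma same_edge_inv f' : f' \in edges K' -> exists2 f, f \in edges K & nrm f' = nrm (rename s f).
Proof.
case: same => _ /perm_mem E fK'.
have : nrm f' \in map nrm (edges (rename_g s K)) by rewrite E; apply: map_f.
by case/mapP=> h /mapP[f fK ->] ->; exists f.
Qed.

Lemma same_incident f f' x : nrm f' = nrm (rename s f) -> incident f' x = incident f x.
Proof. by move=> E; rewrite -incident_nrm E incident_nrm. Qed.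

Lemma same_joins f f' x y : nrm f' = nrm (rename s f) -> joins f' x y = joins f x y.
Proof. by move=> E; rewrite -joins_nrm E joins_nrm. Qed.

Lemma same_kind f f' : nrm f' = nrm (rename s f) ->
  f'.1 = match f.1 with inl i => inl i | inr l => inr (s l) end.
Proof. by move=> /(congr1 fst). Qed.

Lemma same_earc e e' f : earc K e f -> e' \in edges K' -> nrm e' = nrm (rename s e) ->
  exists2 f', earc K' e' f' & nrm f' = nrm (rename s f).
Proof.
move=> A eK' eE; elim: A => [_|g h x _ [g' eg gE] hK ig ih dx].
  by exists e' => //; apply: earc_refl.
have [h' hK' hE] := same_edge hK; exists h' => //.
apply: earc_step eg hK' _ _ _.
- by rewrite (same_incident _ gE); exact: ig.
- by rewrite (same_incident _ hE).
- by rewrite -same_deg.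
Qed.

Lemma same_earc_inv e e' f' : earc K' e' f' -> e \in edges K -> nrm e' = nrm (rename s e) ->
  exists2 f, earc K e f & nrm f' = nrm (rename s f).
Proof.
move=> A eK eE; elim: A => [_|g' h' x _ [g eg gE] hK' ig ih dx].
  by exists e => //; apply: earc_refl.
have [h hK hE] := same_edge_inv hK'; exists h => //.
apply: earc_step eg hK _ _ _.
- by rewrite -(same_incident _ gE); exact: ig.
- by rewrite -(same_incident _ hE).
- by rewrite same_deg.
Qed.

Lemma same_real f f' : nrm f' = nrm (rename s f) -> is_real f' = is_real f.
Proof. by move/same_kind; rewrite /is_real => ->; case: f.1. Qed.

Lemma same_ear_real l : ear_real K l -> ear_real K' (s l).
Proof.
move=> [f [g [fl fg rg]]]; have [f' fK' fE] := same_edge (earc_edgel fg).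
have [g' fg' gE] := same_earc fg fK' fE.
by exists f', g'; split=> //; [rewrite (same_kind fE) fl|rewrite (same_real gE)].
Qed.

Lemma same_ear_real_inv k : ear_real K' k ->
  exists l, [/\ l \in labels_g K, s l = k & ear_real K l].
Proof.
move=> [f' [g' [fk fg' rg]]]; have [f fK fE] := same_edge_inv (earc_edgel fg').
have [g fg gE] := same_earc_inv fg' fK fE.
have := same_kind fE; rewrite fk; case fl: f.1 => [//|l] [sl].
exists l; split=> //; first by apply/labels_gP; exists f.
by exists f, g; split=> //; rewrite -(same_real gE).
Qed.

Lemma same_connected : connected K' -> connected K.
Proof.
case: same => vE _ c x y; rewrite -[verts K]/(verts (rename_g s K)) => xK yK.
have xK' : x \in verts K' by rewrite -vE.
have yK' : y \in verts K' by rewrite -vE.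
elim: {yK yK'} (c x y xK' yK') => [_ _|z f t _ IH fK' _ J _]; first exact: reach_refl.
have [h hK hE] := same_edge_inv fK'; apply: reach_step IH hK _ _ _ => //.
by rewrite -(same_joins _ _ hE).
Qed.

End SameGraph.

(* The component [K] of the split collection determines that its merged counterpart [K0]
   is connected with at least three edges, so only the degrees have to be traced through merges. *)
Lemma deg2_label_cycle K0 K l :
  same_graph (rename_g id K0) K -> loopless K0 -> deg2_all_or_none K0 ->
  connected K -> 2 < size (edges K) -> deg2_label K l ->
  is_cycle K0 /\ exists2 f, f \in edges K0 & f.1 = inr l.
Proof.
move=> same L A c sz [f [fK fl [x jf dx]]].
have [h hK hE] := same_edge_inv same fK; split; last first.
  exists h => //; have := same_kind hE; rewrite fl.
  by case: h.1 => [//|k] [->].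
split; first exact: same_connected same c.
split.
  case: same => _ /perm_size; rewrite !size_map => E; rewrite -/(edges K0).
  by rewrite E.
case: A => // A; case: (A x); last by rewrite (same_deg same).
by apply: incident_vert L hK _; rewrite -(same_incident _ hE).
Qed.

Lemma perm_two_positions (C : seq graph) K L D : perm_eq C (K :: L :: D) ->
  exists i j, [/\ i < size C, j < size C, i <> j, nth g0 C i = K & nth g0 C j = L].
Proof.
rewrite perm_sym => /(perm_iotaP g0) [Is pI]; case: Is pI => [//|i [//|j Is]] pI [-> -> _].
have iI : i \in iota 0 (size C) by rewrite -(perm_mem pI) inE eqxx.
have jI : j \in iota 0 (size C) by rewrite -(perm_mem pI) !inE eqxx orbT.
exists i, j; split=> //; first by move: iI; rewrite mem_iota.
  by move: jI; rewrite mem_iota.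
have := perm_uniq pI; rewrite iota_uniq /= inE negb_or => /andP[/andP[/eqP //]].
Qed.

(* Splits keep [sum |V| - 2 * size] constant and merges can only lower it, so reaching a
   collection that is also obtained by splits alone forces every merge to identify exactly
   the two ends of the merged virtual edge. *)
Lemma tricomp_not_twice_deg2 G r C :
  wf_graph G -> all is_real (edges G) -> biconnected G -> splits [:: G] r C ->
  is_tricomp G C -> ~ twice_deg2 C.
Proof.
move=> W A B R [r0 [S [C0 [R0 ns TM nm iso]]]] [K [L [D [l [P dK dL]]]]].
have I0 := split_inv_start W A B.
have I := split_inv_splits I0 R; have IS := split_inv_splits I0 R0.
have [MI sz le] := tmerges_inv TM (split_merge_inv IS).
have tot := coll_iso_sum_over iso (fun H HC => (mi_loopless MI HC).1) (fun H HC => (si_wf I HC).1).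
have [_ [szC [pi [b inj same]]]] := iso.
have big : 1 < size C by rewrite (perm_size P).
(* Merges only shorten the collection, so [G] was split at least once and all graphs of [S] have at
   least three edges. *)
have bigS : 1 < size S by move: sz; rewrite szC; lia.
have dC0 : forall H, H \in C0 -> deg2_all_or_none H.
  apply: (tmerges_deg2_all_or_none TM (split_merge_inv IS)).
    by have := si_verts I; have := si_verts IS; rewrite tot szC; lia.
  move=> H HS; apply: unsplittable_deg2_all_or_none (ns _ HS).
  - exact: si_wf IS _ HS.
  - exact: si_bi IS _ HS.
  - exact: si_edges IS bigS _ HS.
rewrite -szC in b; have onto := bounded_inj_onto b inj.
have [i' [j' [iC jC ij iK jL]]] := perm_two_positions P.
rewrite -szC in iC jC; have [i i0 iE] := onto _ iC; have [j j0 jE] := onto _ jC.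
have cyc k H : k < size C0 -> nth g0 C (pi k) = H -> deg2_label H l ->
    is_cycle (nth g0 C0 k) /\ exists2 f, f \in edges (nth g0 C0 k) & f.1 = inr l.
  move=> kC kH; have HC : H \in C by rewrite -kH mem_nth // -szC b.
  have kC0 := mem_nth g0 kC.
  apply: deg2_label_cycle.
  - by rewrite -kH; apply: same.
  - exact: mi_loopless MI _ kC0.
  - exact: dC0.
  - by case: (si_bi I HC).
  - exact: si_edges I big _ HC.
have cK := cyc i K i0 ltac:(by rewrite iE) dK.
have cL := cyc j L j0 ltac:(by rewrite jE) dL.
have ne : i <> j by move=> E; apply: ij; rewrite -iE -jE E.
(* Two cycles of [C0] that share a label admit one more typed merge, contradicting [nm]. The
   positions are ordered because [merge_ok] wants the smaller one first. *)
suff go p q : p < q -> q < size C0 ->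
    is_cycle (nth g0 C0 p) /\ (exists2 f, f \in edges (nth g0 C0 p) & f.1 = inr l) ->
    is_cycle (nth g0 C0 q) /\ (exists2 f, f \in edges (nth g0 C0 q) & f.1 = inr l) -> False.
  have [ltij|ltji|//] := ltngtP i j; first exact: go ltij j0 cK cL.
  exact: go ltji i0 cL cK.
move=> pq qC [cp [f fp fl]] [cq [g gq gl]]; apply: nm.
exists p, q, l; eexists; split; last by left.
have pC := ltn_trans pq qC.
have fg := mi_ends MI (mem_nth g0 pC) (mem_nth g0 qC) fp gq fl gl.
split=> //.
have fE (h : edge) : h.1 = inr l -> h = vedge l h.2.1 h.2.2 by case: h => k [a c] /= ->.
exists f.2.1, f.2.2; split; first by rewrite -(fE f fl).
by left; rewrite fg -(fE g gl).
Qed.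

(** Different runs choose their labels independently, so the colourings are compared along an
    isomorphism [s] of the final collections, which preserves ears and real edges. *)
Theorem theorem3 (G : graph)
  (hwf : wf_graph G) (hnv : all is_real (edges G)) (hbi : biconnected G)
  (r1 r2 : seq sstep) (C1 C2 : seq graph) (col1 col2 : nat -> option colour)
  (h1 : crun [:: G] (fun _ => None) r1 C1 col1)
  (h2 : crun [:: G] (fun _ => None) r2 C2 col2)
  (t1 : is_tricomp G C1) (t2 : is_tricomp G C2)
  (s : nat -> nat) (hiso : coll_iso s C1 C2) :
  forall l, l \in labels C1 -> col1 l = col2 (s l).
Proof.
have I := split_inv_start hwf hnv hbi.
have c0 : coloured [:: G] (fun _ => None).
  move=> l /labelsP[H [f []]]; rewrite inE => /eqP-> /(allP hnv) rf fl.
  by case: (not_real_label fl).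
have run r C col : crun [:: G] (fun _ => None) r C col -> is_tricomp G C -> coloured C col.
  move=> h t; apply: coloured_crun (h) I _ c0.
  exact: tricomp_not_twice_deg2 hwf hnv hbi (crun_splits h) t.
have cc1 := run _ _ _ h1 t1; have cc2 := run _ _ _ h2 t2.
move=> l lC; have [inj [sz [pi [b pinj same]]]] := hiso.
rewrite -sz in b; have onto := bounded_inj_onto b pinj.
have slC : s l \in labels C2.
  case/labelsP: lC => H [f [/(nthP g0)[i iC <-] fH fl]].
  have [f' fH' fE] := same_edge (same _ iC) fH.
  apply/labelsP; exists (nth g0 C2 (pi i)), f'; split=> //.
    by apply: mem_nth; rewrite -sz b.
  by rewrite (same_kind fE) fl.
have E : some_ear_real C1 l <-> some_ear_real C2 (s l).
  split=> [[K /(nthP g0)[i iC <-]] /(same_ear_real (same _ iC)) r|].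
    by exists (nth g0 C2 (pi i)) => //; apply: mem_nth; rewrite -sz b.
  case=> K /(nthP g0)[j]; rewrite -sz => /onto [i iC <-] <-.
  move=> /(same_ear_real_inv (same _ iC)) [k [kK ks r]].
  have KC := mem_nth g0 iC.
  (* The green ear in [C2] pulls back to some label with the same image as [l]; injectivity of [s]
     on the labels of [C1] identifies the two. *)
  have kl : k = l.
    apply: inj => //; apply/labelsP; case/labels_gP: kK => f fK fk.
    by exists (nth g0 C1 i), f.
  by exists (nth g0 C1 i); rewrite -?kl.
have [g1 d1] := cc1 _ lC; have [g2 d2] := cc2 _ slC.
case: (classic (some_ear_real C1 l)) => [r|nr].
  by rewrite g1 // g2 //; apply/E.
by rewrite d1 // d2 // => /E.
Qed.
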